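(* Let $m\ge 3$. There exists a real polynomial $\mathfrak{P}_m=\mathfrak{P}_m(\Gamma)$ on $\mathcal{W}(m)$, divisible by $\det(\rho_{s,\Gamma})$ and not vanishing identically on $\mathcal{Z}(m)$, such that for all $(p,q)$ with $p+q=m$ the following holds. The sets $$\mathcal{W}(p,q;\mathfrak{P}_m):=\{\Gamma\in\mathcal{W}(p,q):\mathfrak{P}_m(\Gamma)\ne0\},\qquad \mathcal{Z}(p,q;\mathfrak{P}_m):=\{\Gamma\in\mathcal{Z}(p,q):\mathfrak{P}_m(\Gamma)\ne0\}$$ are $\operatorname{GL}^+(m,\mathbb{R})$-invariant, and $\operatorname{GL}^+(m,\mathbb{R})$ acts on each of them properly and without fixed points. Consequently, there are natural smooth structures on the quotients $\mathfrak{W}^+(p,q;\mathfrak{P}_m):=\mathcal{W}(p,q;\mathfrak{P}_m)/\operatorname{GL}^+(m,\mathbb{R})$ and $\mathfrak{Z}^+(p,q;\mathfrak{P}_m):=\mathcal{Z}(p,q;\mathfrak{P}_m)/\operatorname{GL}^+(m,\mathbb{R})$ such that the projections $\mathcal{W}(p,q;\mathfrak{P}_m)\to\mathfrak{W}^+(p,q;\mathfrak{P}_m)$ and $\mathcal{Z}(p,q;\mathfrak{P}_m)\to\mathfrak{Z}^+(p,q;\mathfrak{P}_m)$ are smooth principal $\operatorname{GL}^+(m,\mathbb{R})$ bundles.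
   Context: $\mathcal{W}(m)=(\mathbb{R}^m)^*\otimes(\mathbb{R}^m)^*\otimes\mathbb{R}^m$ is the vector space of arrays $\Gamma=(\Gamma_{ij}{}^k)_{1\le i,j,k\le m}$ of real constants (constant Christoffel symbols of a connection on $\mathbb{R}^m$, $\nabla_{\partial_{x^i}}\partial_{x^j}=\Gamma_{ij}{}^k\partial_{x^k}$), and $\mathcal{Z}(m)\subset\mathcal{W}(m)$ is the subspace where $\Gamma_{ij}{}^k=\Gamma_{ji}{}^k$ (torsion free). Repeated indices are summed. The Ricci tensor of $\Gamma$ is $\rho_{\Gamma,jk}=\Gamma_{in}{}^i\Gamma_{jk}{}^n-\Gamma_{jn}{}^i\Gamma_{ik}{}^n$, and the symmetric Ricci tensor is $\rho_{s,\Gamma,jk}=\frac12(\rho_{\Gamma,jk}+\rho_{\Gamma,kj})$; $\det(\rho_{s,\Gamma})$ is the determinant of this $m\times m$ matrix. For $p+q=m$, $\mathcal{W}(p,q)$ (resp. $\mathcal{Z}(p,q)$) is the set of $\Gamma\in\mathcal{W}(m)$ (resp. $\mathcal{Z}(m)$) for which $\rho_{s,\Gamma}$ is non-degenerate with signature $(p,q)$: $p$ negative (timelike) and $q$ positive (spacelike) directions. $\operatorname{GL}^+(m,\mathbb{R})$ is the group of linear maps of $\mathbb{R}^m$ with positive determinant. It acts on $\mathcal{W}(m)$, preserving $\mathcal{Z}(m)$, by change of coordinates: $(T\Gamma)(e_i,e_j,e^k)=\Gamma(Te_i,Te_j,Te^k)$, where $\Gamma(e_i,e_j,e^k)=\Gamma_{ij}{}^k$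 and $T$ acts on covectors by the dual action (so that $\langle Te^k,Te_i\rangle=\delta^k_i$). An action of a Lie group $G$ on a space $N$ is without fixed points if every isotropy group $\{g\in G: gP=P\}$, $P\in N$, is trivial. It is proper if whenever $P_n\in N$, $g_n\in G$ with $P_n\to P\in N$ and $g_nP_n\to\tilde P\in N$, some subsequence of $g_n$ converges in $G$. *)

(* Defs.v *)
From HB Require Import structures.
From mathcomp Require Import all_boot all_order all_algebra.
From mathcomp Require Import generic_quotient.
From mathcomp Require Import all_classical all_reals all_analysis.
From mathcomp Require mpoly.

Set Implicit Arguments.
Unset Strict Implicit.
Unset Printing Implicit Defensive.

Import Order.TTheory GRing.Theory Num.Theory.
Import numFieldNormedType.Exports.

Local Open Scope classical_set_scope.
Local Open Scope ring_scope.
Local Open Scope quotient_scope.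

Section Smooth.
Context {R : realType}.

(* C^k along the linear subspace L, on a set A that is relatively open in L:
   the derivatives of f in the directions of L exist on A up to order k and
   are continuous on A.  Derivatives along L at a point of A involve only
   values of f near that point inside A, so the values of f off A do not
   matter.  With L = setT and A open this is the usual notion of a C^k map. *)
Fixpoint Ck_on {E F : normedModType R} (L A : set E) (k : nat) (f : E -> F)
    : Prop :=
  {within A, continuous f} /\
  if k is k'.+1 then
    forall v, L v ->
      (forall x, A x -> derivable f x v) /\ Ck_on L A k' (fun x => 'D_v f x)
  else True.

Definition smooth_on {E F : normedModType R} (L A : set E) (f : E -> F) : Prop :=
  forall k, Ck_on L A k f.

(* smoothness on a subset D of N for a map that is only defined on N *)
Definition sub_smooth_on {E F : normedModType R} (L N : set E) (D : set N)
    (f : N -> F) : Prop :=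
  exists2 g : E -> F,
    (forall x : N, D x -> g (val x) = f x) &
    smooth_on L [set val x | x in D] g.

Record chart (B : topologicalType) (d : nat) := Chart {
  cdom : set B;
  cmap : B -> 'rV[R]_d;
  cinv : 'rV[R]_d -> B }.

Definition is_chart (B : topologicalType) d (c : chart B d) : Prop :=
  [/\ open (cdom c),
      open [set cmap c b | b in cdom c],
      (forall b, cdom c b -> cinv c (cmap c b) = b),
      {within cdom c, continuous (cmap c)} &
      {within [set cmap c b | b in cdom c], continuous (cinv c)}].

Definition smooth_atlas (B : topologicalType) d (A : set (chart B d)) : Prop :=
  [/\ (forall c, A c -> is_chart c),
      (forall b, exists2 c, A c & cdom c b) &
      (forall c1 c2, A c1 -> A c2 ->
         smooth_on setT [set cmap c1 b | b in cdom c1 `&` cdom c2]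
           (fun y => cmap c2 (cinv c1 y)))].

Definition smooth_manifold (B : topologicalType) d (A : set (chart B d)) : Prop :=
  [/\ hausdorff_space B, @second_countable B & smooth_atlas A].

End Smooth.

Section GLplus.
Context {R : realType} {m : nat}.

(* A matrix A stands for the linear map e_i |-> col i A, so that products of
   matrices are composites of linear maps. *)
Definition GLplus : set 'M[R]_m := [set A | 0 < \det A].

Section Action.
Context {E : normedModType R} (act : 'M[R]_m -> E -> E).

Definition invariant_set (N : set E) : Prop :=
  forall g x, GLplus g -> N x -> N (act g x).

Definition without_fixed_points (N : set E) : Prop :=
  forall x, N x -> [set g | GLplus g /\ act g x = x] = [set 1%:M].

Definition proper_action (N : set E) : Prop :=
  forall (x : nat -> E) (g : nat -> 'M[R]_m) (a b : E),
    (forall n, N (x n)) -> (forall n, GLplus (g n)) ->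
    N a -> x n @[n --> \oo] --> a ->
    N b -> act (g n) (x n) @[n --> \oo] --> b ->
    exists s : nat -> nat, {homo s : i j / (i < j)%N} /\
    exists2 g0, GLplus g0 & g (s n) @[n --> \oo] --> g0.

Definition orbit_of (x : E) : set E := [set act g x | g in GLplus].

Definition orbit_rel (N : set E) : rel N :=
  fun x y => `[< orbit_of (val x) = orbit_of (val y) >].

Lemma orbit_rel_refl (N : set E) : reflexive (@orbit_rel N).
Proof. by move=> x; apply/asboolP. Qed.

Lemma orbit_rel_sym (N : set E) : symmetric (@orbit_rel N).
Proof. by move=> x y; apply/asboolP/asboolP => ->. Qed.

Lemma orbit_rel_trans (N : set E) : transitive (@orbit_rel N).
Proof. by move=> y x z /asboolP xy /asboolP yz; apply/asboolP; rewrite xy. Qed.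

Canonical orbit_equiv (N : set E) := EquivRel (@orbit_rel N)
  (@orbit_rel_refl N) (@orbit_rel_sym N) (@orbit_rel_trans N).

Definition orbit_space (N : set E) : topologicalType :=
  quotient_topology {eq_quot @orbit_equiv N}.

Definition orbit_proj (N : set E) (x : N) : orbit_space N :=
  \pi_(quotient_topology {eq_quot @orbit_equiv N}) x.

(* A local trivialization over U is x |-> (pi x, phi x), with inverse
   (b, g) |-> psi b g.  The structure group acts from the right: in the cases
   of interest act g (act h x) = act (h *m g) x. *)
Definition local_trivialization (L N : set E) (B : topologicalType) (pi : N -> B)
    d (A : set (chart B d)) (U : set B)
    (phi : E -> 'M[R]_m) (psi : B -> 'M[R]_m -> E) : Prop :=
  [/\ (forall x : N, U (pi x) ->
         GLplus (phi (val x)) /\ psi (pi x) (phi (val x)) = val x),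
      (forall b g, U b -> GLplus g ->
         exists x : N, [/\ val x = psi b g, pi x = b & phi (val x) = g]),
      (forall (x : N) g, U (pi x) -> GLplus g ->
         phi (act g (val x)) = phi (val x) *m g),
      smooth_on L [set val x | x in pi @^-1` U] phi &
      (forall c, A c ->
         smooth_on setT ([set cmap c b | b in U `&` cdom c] `*` GLplus)
           (fun yg : 'rV[R]_d * 'M[R]_m => psi (cinv c yg.1) yg.2))].

(* The total space N is a relatively open subset of the linear subspace L. *)
Definition smooth_principal_bundle (L N : set E) (B : topologicalType)
    (pi : N -> B) d (A : set (chart B d)) : Prop :=
  (exists2 O : set E, open O & N = O `&` L) /\
  smooth_manifold A /\
  smooth_on (L `*` setT) (N `*` GLplus)
    (fun xg : E * 'M[R]_m => act xg.2 xg.1) /\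
  (forall b, exists x, pi x = b) /\
  (forall x y : N, pi x = pi y <-> exists2 g, GLplus g & val y = act g (val x)) /\
  (forall c, A c ->
     sub_smooth_on L (pi @^-1` cdom c) (fun x => cmap c (pi x))) /\
  (forall b, exists U phi psi,
     [/\ open U, U b & local_trivialization L pi A U phi psi]).

End Action.
End GLplus.

Section Christoffel.
Context {R : realType} {m : nat}.

Implicit Types (G : 'M[R]_(m * m, m)) (i j k : 'I_m).

(* Christoffel arrays are matrices with rows indexed by (i, j), columns by k. *)
Definition chr G i j k : R := G (mxvec_index i j) k.

Definition mk_chr (f : 'I_m -> 'I_m -> 'I_m -> R) : 'M[R]_(m * m, m) :=
  (\matrix_(k < m) mxvec (\matrix_(i, j) f i j k))^T.

Definition torsion_free : set 'M[R]_(m * m, m) :=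
  [set G | forall i j k, chr G i j k = chr G j i k].

Definition ricci G : 'M[R]_m :=
  \matrix_(j, k) \sum_i \sum_n
    (chr G i n i * chr G j k n - chr G j n i * chr G i k n).

Definition ricci_s G : 'M[R]_m :=
  \matrix_(j, k) (2^-1 * (ricci G j k + ricci G k j)).

(* The form S is non-degenerate with p negative and q positive directions: it
   has an orthonormal basis, given by the columns of B. *)
Definition has_signature (p q : nat) (S : 'M[R]_m) : Prop :=
  (p + q)%N = m /\
  exists2 B, B \in unitmx &
    B^T *m S *m B = diag_mx (\row_(i < m) (if (i < p)%N then -1 else 1)).

(* G as a trilinear form on two vectors and a covector *)
Definition chr_form G (x y : 'cV[R]_m) (w : 'rV[R]_m) : R :=
  \sum_i \sum_j \sum_k x i 0 * y j 0 * w 0 k * chr G i j k.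

(* T e_i = col i T, and the dual action on covectors is T e^k = row k T^-1. *)
Definition chr_act (T : 'M[R]_m) G : 'M[R]_(m * m, m) :=
  mk_chr (fun i j k => chr_form G (col i T) (col j T) (row k (invmx T))).

Definition chr_poly : Type := mpoly.mpoly (m * m * m) R.

Definition chr_eval (P : chr_poly) G : R :=
  mpoly.meval (fun r : 'I_(m * m * m) => mxvec G 0 r) P.

(* L is either all of W(m), or the torsion free subspace. *)
Definition chr_stratum (L : set 'M[R]_(m * m, m)) (p q : nat) (P : chr_poly) :
    set 'M[R]_(m * m, m) :=
  [set G | [/\ L G, has_signature p q (ricci_s G) & chr_eval P G != 0]].

End Christoffel.

Arguments chr_poly : clear implicits.

(* Main.v *)
Require Import Defs.
From HB Require Import structures.
From mathcomp Require Import all_boot all_order all_algebra.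
From mathcomp Require Import generic_quotient zify.
From mathcomp Require Import all_classical all_reals all_analysis.
From mathcomp Require mpoly.

Set Implicit Arguments.
Unset Strict Implicit.
Unset Printing Implicit Defensive.

Import Order.TTheory GRing.Theory Num.Theory.
Import numFieldNormedType.Exports.

Local Open Scope classical_set_scope.
Local Open Scope ring_scope.

(* A connection with constant Christoffel symbols is an algebra structure
   x.y = Gamma(x, y) on R^m. Its trace covector w(x) = tr (y |-> x.y) and the
   bilinear form b(x, y) = w(x.y) are equivariant; when b is non-degenerate there
   is a unique vector v with b(v, _) = w. If the iterates v, v.v, v.(v.v), ...
   (m of them) are independent, they form a frame F(Gamma) with
   F(g Gamma) = g^-1 F(Gamma), so that g is recovered from Gamma and g Gamma:
   this gives freeness and properness on the locus where
   det rho_s, det b and det F do not vanish.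
   On this locus F(Gamma) = 1 amounts to linear equations on Gamma, since it
   forces w to be a constant multiple of (1, ..., 1). Hence
   Gamma |-> F(Gamma) Gamma maps the locus onto an open subset of an affine
   space, which yields charts of the quotient and trivializations that are
   rational in the Christoffel symbols; two charts are needed, one for each sign
   of det F. *)

(** * Smooth functions along a linear subspace *)

(** The form rho_s alone only reduces GL(m) to O(p,q), so a full frame has to be extracted from
    Gamma itself, by formulas that survive on torsion free arrays, because one polynomial must serve
    both W(m) and Z(m). An equivariant frame makes the action look like translation on invertible
    matrices: each orbit of all of GL(m) contains exactly one point with F = 1, and freeness,
    properness and local triviality follow formally. The obstacle is to parametrize F = 1. Besides
    the linear conditions e_0.e_i = e_(i+1), it contains v = e_0, that is b(e_0, e_i) = w(e_i),
    which is quadratic in Gamma. After substitution of the linear part these equations read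
    w(e_(i+1)) = w(e_i) for i < m - 1, and the last one becomes linear on division by the common
    value of w, nonzero because v is nonzero. The signature is an open invariant condition and
    merely selects a part of the locus. Nonvanishing on Z(m) is shown with a family of commutative
    algebras whose iterates of v become triangular in a degenerate limit. *)

Section RingClosedFunctions.
Context {T : Type} {R : comNzRingType} (C : (T -> R) -> Prop).
Hypothesis C_cst : forall a, C (fun=> a).
Hypothesis C_add : forall f g, C f -> C g -> C (fun x => f x + g x).
Hypothesis C_mul : forall f g, C f -> C g -> C (fun x => f x * g x).

(** The class [C] is later instantiated by continuous functions, by functions smooth along a
    subspace and by polynomials in the Christoffel symbols, so that each matrix formula is checked
    once for all three. *)
Definition entrywise m n (f : T -> 'M[R]_(m, n)) : Prop :=
  forall i j, C (fun x => f x i j).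

Lemma closed_sum I (r : seq I) (P : pred I) (f : I -> T -> R) :
  (forall i, C (f i)) -> C (fun x => \sum_(i <- r | P i) f i x).
Proof.
move=> Cf; elim: r => [|i r IH].
  by rewrite [X in C X](_ : _ = (fun=> 0)) //; apply/funext => x; rewrite big_nil.
rewrite [X in C X](_ : _ = (fun x => (if P i then f i x else 0) +
    \sum_(j <- r | P j) f j x)).
  by apply: C_add => //; case: (P i).
by apply/funext => x; rewrite big_cons; case: (P i); rewrite ?add0r.
Qed.

Lemma closed_prod I (r : seq I) (P : pred I) (f : I -> T -> R) :
  (forall i, C (f i)) -> C (fun x => \prod_(i <- r | P i) f i x).
Proof.
move=> Cf; elim: r => [|i r IH].
  by rewrite [X in C X](_ : _ = (fun=> 1)) //; apply/funext => x; rewrite big_nil.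
rewrite [X in C X](_ : _ = (fun x => (if P i then f i x else 1) *
    \prod_(j <- r | P j) f j x)).
  by apply: C_mul => //; case: (P i).
by apply/funext => x; rewrite big_cons; case: (P i); rewrite ?mul1r.
Qed.

Lemma closed_det n (f : T -> 'M[R]_n) : entrywise f -> C (fun x => \det (f x)).
Proof.
move=> Cf; apply: closed_sum => s; apply: C_mul; first exact: C_cst.
by apply: closed_prod => i; exact: Cf.
Qed.

Lemma entrywise_cst m n (A : 'M[R]_(m, n)) : entrywise (fun=> A).
Proof. by move=> i j; exact: C_cst. Qed.

Lemma entrywise_mul m n p (f : T -> 'M[R]_(m, n)) (g : T -> 'M[R]_(n, p)) :
  entrywise f -> entrywise g -> entrywise (fun x => f x *m g x).
Proof.
move=> Cf Cg i j; rewrite [X in C X](_ : _ = (fun x => \sum_k f x i k * g x k j)).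
  by apply: closed_sum => k; apply: C_mul.
by apply/funext => x; rewrite mxE.
Qed.

Lemma entrywise_tr m n (f : T -> 'M[R]_(m, n)) :
  entrywise f -> entrywise (fun x => (f x)^T).
Proof.
move=> Cf i j; rewrite [X in C X](_ : _ = (fun x => f x j i)) //.
by apply/funext => x; rewrite mxE.
Qed.

Lemma entrywise_adj n (f : T -> 'M[R]_n) :
  entrywise f -> entrywise (fun x => \adj (f x)).
Proof.
move=> Cf i j.
rewrite [X in C X](_ : _ =
    (fun x => (-1) ^+ (j + i) * \det (row' j (col' i (f x))))).
  apply: C_mul; first exact: C_cst.
  apply: closed_det => k l.
  rewrite [X in C X](_ : _ = (fun x => f x (lift j k) (lift i l))) //.
  by apply/funext => x; rewrite !mxE.
by apply/funext => x; rewrite mxE.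
Qed.

End RingClosedFunctions.

Section Smoothness.
Context {R : realType}.

Lemma cvg_mx {T : Type} (F : set_system T) {FF : Filter F} m n
    (f : T -> 'M[R]_(m, n)) (M : 'M[R]_(m, n)) :
  (forall i j, f x i j @[x --> F] --> M i j) -> f x @[x --> F] --> M.
Proof.
move=> fM B [P MP sPB].
have : \forall x \near F, forall ij : 'I_m * 'I_n, P ij.1 ij.2 (f x ij.1 ij.2).
  by apply: filter_forall => ij; exact: fM (MP ij.1 ij.2).
by apply: filterS => x Px; apply: sPB => i j; exact: (Px (i, j)).
Qed.

Definition linear_set (E : lmodType R) (L : set E) : Prop :=
  L 0 /\ forall (a : R) x y, L x -> L y -> L (a *: x + y).

(** Openness is asked only along lines in the directions of [L]: this is what makes a directional
    derivative at a point of [A] depend only on values on [A]. *)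
Definition rel_open (E : normedModType R) (L A : set E) : Prop :=
  forall x v, A x -> L v -> \forall h \near (0 : R), A (h *: v + x).

Definition smooth_real (E : normedModType R) (L A : set E) (f : E -> R) : Prop :=
  smooth_on L A f.

Section Domain.
Context {E : normedModType R} (L A : set E).
Hypothesis LA : rel_open L A.


Lemma near_difference_quotient {F : normedModType R} (f g : E -> F) x v :
  (forall y, A y -> f y = g y) -> A x -> L v ->
  \forall h \near (0 : R)^',
    h^-1 *: ((f \o shift x) (h *: v) - f x) =
    h^-1 *: ((g \o shift x) (h *: v) - g x).
Proof.
move=> fg Ax Lv; apply: nbhs_dnbhs.
by apply: filterS (LA Ax Lv) => h /= hA; rewrite !fg.
Qed.

Lemma eq_on_derivable {F : normedModType R} (f g : E -> F) x v :
  (forall y, A y -> f y = g y) -> A x -> L v ->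
  derivable f x v -> derivable g x v.
Proof.
move=> fg Ax Lv /cvg_ex[l fl]; apply/cvg_ex; exists l.
apply: cvg_trans fl; apply: near_eq_cvg.
by apply: near_difference_quotient => // y Ay; rewrite fg.
Qed.

Lemma eq_on_derive {F : normedModType R} (f g : E -> F) x v :
  (forall y, A y -> f y = g y) -> A x -> L v -> 'D_v f x = 'D_v g x.
Proof.
move=> fg Ax Lv; rewrite /derive; congr (lim _).
rewrite eqEsubset; split; apply: near_eq_cvg;
  by apply: near_difference_quotient => // y Ay; rewrite fg.
Qed.

Lemma eq_within_continuous {F : topologicalType} (f g : E -> F) :
  (forall y, A y -> f y = g y) ->
  {within A, continuous f} -> {within A, continuous g}.
Proof.
by move=> fg; apply: subspace_eq_continuous => x /set_mem Ax; exact: fg.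
Qed.

(** Allows a map to be replaced by a formula valid only on [A], in particular a derivative by what
    the rules of calculus give there. *)
Lemma eq_Ck {F : normedModType R} k (f g : E -> F) :
  (forall y, A y -> f y = g y) -> Ck_on L A k f -> Ck_on L A k g.
Proof.
elim: k f g => [|k IH] f g fg [cf] /=.
  by move=> _; split => //; apply: eq_within_continuous cf.
move=> df; split; first exact: eq_within_continuous cf.
move=> v Lv; have [dfv Cdf] := df v Lv; split.
  by move=> x Ax; apply: eq_on_derivable (dfv x Ax).
by apply: IH Cdf => x Ax; exact: eq_on_derive.
Qed.

Lemma Ck_continuous {F : normedModType R} k (f : E -> F) :
  Ck_on L A k f -> {within A, continuous f}.
Proof. by case: k => [|k] []. Qed.

Lemma Ck_pred {F : normedModType R} k (f : E -> F) :
  Ck_on L A k.+1 f -> Ck_on L A k f.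
Proof.
elim: k f => [|k IH] f [cf df]; first by split.
split => // v Lv; have [dfv Cdf] := df v Lv; split => //; exact: IH.
Qed.

Lemma Ck_cst {F : normedModType R} k (a : F) : Ck_on L A k (fun=> a).
Proof.
elim: k a => [|k IH] a; first by split=> // x; exact: cvg_cst.
split; first by move=> x; exact: cvg_cst.
move=> v Lv; split; first by move=> x _; exact: derivable_cst.
apply: (@eq_Ck _ _ (fun=> 0)) (IH _) => y _.
by rewrite derive_cst.
Qed.

Lemma Ck_add k (f g : E -> R) :
  Ck_on L A k f -> Ck_on L A k g -> Ck_on L A k (fun x => f x + g x).
Proof.
elim: k f g => [|k IH] f g [cf df] [cg dg].
  by split=> // x; apply: cvgD; [exact: cf|exact: cg].
split; first by move=> x; apply: cvgD; [exact: cf|exact: cg].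
move=> v Lv; have [dfv Cdf] := df v Lv; have [dgv Cdg] := dg v Lv; split.
  by move=> x Ax; apply: derivableD; [exact: dfv|exact: dgv].
apply: eq_Ck (IH _ _ Cdf Cdg) => x Ax.
by rewrite -deriveD; [|exact: dfv|exact: dgv].
Qed.

(** Induction by the Leibniz rule; in each term the undifferentiated factor is brought down to order
    [k] by [Ck_pred]. *)
Lemma Ck_mul k (f g : E -> R) :
  Ck_on L A k f -> Ck_on L A k g -> Ck_on L A k (fun x => f x * g x).
Proof.
elim: k f g => [|k IH] f g Cf Cg.
  by split=> // x; apply: cvgM; [exact: (Ck_continuous Cf)|exact: (Ck_continuous Cg)].
split.
  by move=> x; apply: cvgM; [exact: (Ck_continuous Cf)|exact: (Ck_continuous Cg)].
have [cf df] := Cf; have [cg dg] := Cg.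
move=> v Lv; have [dfv Cdf] := df v Lv; have [dgv Cdg] := dg v Lv; split.
  by move=> x Ax; apply: derivableM; [exact: dfv|exact: dgv].
apply: eq_Ck (Ck_add (IH _ _ (Ck_pred Cf) Cdg) (IH _ _ (Ck_pred Cg) Cdf)) => x Ax.
by rewrite [RHS](deriveM (dfv x Ax) (dgv x Ax)).
Qed.

(** The derivative of 1/f is -(1/f)^2 f', so the induction hypothesis for 1/f itself, together with
    products, gives the next order. *)
Lemma Ck_inv k (f : E -> R) :
  (forall x, A x -> f x != 0) -> Ck_on L A k f -> Ck_on L A k (fun x => (f x)^-1).
Proof.
move=> f0; elim: k => [|k IH] Cf.
  split=> //; apply/subspace_continuousP => x Ax; apply: cvgV; first exact: f0.
  by move/subspace_continuousP : (Ck_continuous Cf); exact.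
have Cg := IH (Ck_pred Cf); have [cf df] := Cf; split.
  exact: (Ck_continuous Cg).
move=> v Lv; have [dfv Cdf] := df v Lv; split.
  by move=> x Ax; apply: derivableV; [exact: f0|exact: dfv].
apply: eq_Ck (Ck_mul (Ck_cst k (-1 : R)) (Ck_mul (Ck_mul Cg Cg) Cdf)) => x Ax.
rewrite deriveV; [|exact: f0|exact: dfv].
by rewrite /GRing.scale /= -exprVn expr2 mulN1r mulNr.
Qed.

(** The difference quotient in direction [v] equals [f v] for every nonzero [h], so all first
    derivatives are constant functions. *)
Lemma Ck_linear {F : normedModType R} k (f : E -> F) :
  (forall (a : R) x y, f (a *: x + y) = a *: f x + f y) ->
  continuous f -> Ck_on L A k f.
Proof.
case: k => [|k] lf cf; first by split => //; exact: continuous_subspaceT.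
have df x v : is_derive x v f (f v).
  have fx : (fun h : R => h^-1 *: ((f \o shift x) (h *: v) - f x)) @ 0^' --> f v.
    have fE : \forall h \near (0 : R)^',
        f v = h^-1 *: ((f \o shift x) (h *: v) - f x).
      near=> h; have h0 : h != 0 by near: h; exact: nbhs_dnbhs_neq.
      by rewrite /= lf addrK scalerA mulVf ?scale1r.
    by apply: cvg_trans (near_eq_cvg fE) _; exact: cvg_cst.
  apply: DeriveDef; last exact: cvg_lim fx.
    by apply/cvg_ex; exists (f v).
split; first exact: continuous_subspaceT.
move=> v _; split; first by move=> x _; case: (df x v).
by apply: eq_Ck (Ck_cst k (f v)) => x _; rewrite (@derive_val _ _ _ _ _ _ _ (df x v)).
Unshelve. all: by end_near. Qed.

Lemma Ck_mx m n k (f : E -> 'M[R]_(m, n)) :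
  (forall i j, Ck_on L A k (fun x => f x i j)) -> Ck_on L A k f.
Proof.
have cmx (g : E -> 'M[R]_(m, n)) :
    (forall i j, {within A, continuous (fun x => g x i j)}) ->
    {within A, continuous g}.
  by move=> cg x; apply: cvg_mx => i j; exact: cg.
elim: k f => [|k IH] f Cf; first by split => //; apply: cmx => i j; case: (Cf i j).
split; first by apply: cmx => i j; case: (Cf i j).
move=> v Lv.
have dfv x : A x -> derivable f x v.
  by move=> Ax; apply/derivable_mxP => i j; have [_ /(_ v Lv)[+ _]] := Cf i j; exact.
split => //; apply: IH => i j.
have [_ /(_ v Lv)[_ Cdf]] := Cf i j.
by apply: eq_Ck Cdf => x Ax; rewrite derive_mx ?mxE //; exact: dfv.
Qed.


Lemma eq_smooth {F : normedModType R} (f g : E -> F) :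
  (forall y, A y -> f y = g y) -> smooth_on L A f -> smooth_on L A g.
Proof. by move=> fg Cf k; apply: eq_Ck (Cf k). Qed.

Lemma smooth_cst {F : normedModType R} (a : F) : smooth_on L A (fun=> a).
Proof. by move=> k; exact: Ck_cst. Qed.

Lemma smooth_real_cst a : smooth_real L A (fun=> a).
Proof. exact: smooth_cst. Qed.

Lemma smooth_add (f g : E -> R) :
  smooth_real L A f -> smooth_real L A g -> smooth_real L A (fun x => f x + g x).
Proof. by move=> Cf Cg k; apply: Ck_add. Qed.

Lemma smooth_mul (f g : E -> R) :
  smooth_real L A f -> smooth_real L A g -> smooth_real L A (fun x => f x * g x).
Proof. by move=> Cf Cg k; apply: Ck_mul. Qed.

Lemma smooth_mx m n (f : E -> 'M[R]_(m, n)) :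
  entrywise (smooth_real L A) f -> smooth_on L A f.
Proof. by move=> Cf k; apply: Ck_mx => i j; exact: Cf. Qed.

Lemma smooth_invmx n (f : E -> 'M[R]_n) :
  (forall x, A x -> f x \in unitmx) ->
  entrywise (smooth_real L A) f -> entrywise (smooth_real L A) (fun x => invmx (f x)).
Proof.
move=> fu Cf i j.
have Cdet : smooth_real L A (fun x => \det (f x)).
  by apply: closed_det Cf; [exact: smooth_real_cst|exact: smooth_add|exact: smooth_mul].
have Cadj : smooth_real L A (fun x => (\adj (f x)) i j).
  by apply: entrywise_adj Cf i j;
    [exact: smooth_real_cst|exact: smooth_add|exact: smooth_mul].
have Cinv : smooth_real L A (fun x => (\det (f x))^-1).
  by move=> k; apply: Ck_inv => // x Ax; rewrite -unitfE -unitmxE fu.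
apply: eq_smooth (smooth_mul Cinv Cadj) => x Ax.
by rewrite /invmx fu // !mxE.
Qed.

End Domain.

Lemma smooth_subset {E F : normedModType R} (L A B : set E) (f : E -> F) :
  A `<=` B -> smooth_on L B f -> smooth_on L A f.
Proof.
move=> AB Cf k; move: (Cf k); elim: k f {Cf} => [|k IH] f [cf df].
  by split=> //; exact: continuous_subspaceW cf.
split; first exact: continuous_subspaceW cf.
by move=> v Lv; have [dfv Cdf] := df v Lv; split; [move=> x /AB; exact: dfv|exact: IH].
Qed.

(** Serves the overlap of two charts belonging to opposite signs of the frame determinant, which is
    empty. *)
Lemma smooth_set0 {E F : normedModType R} (L : set E) (f : E -> F) :
  smooth_on L set0 f.
Proof.
by move=> k; elim: k f => [|k IH] f; split => //; exact: continuous_subspace0.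
Qed.

Lemma smooth_coord m n (L A : set 'M[R]_(m, n)) i j :
  rel_open L A -> smooth_real L A (fun x => x i j).
Proof.
move=> LA k; apply: Ck_linear => //; first by move=> a x y; rewrite !mxE.
exact: coord_continuous.
Qed.

Lemma smooth_coord1 m n (E : normedModType R) (L A : set ('M[R]_(m, n) * E)) i j :
  rel_open L A -> smooth_real L A (fun x => x.1 i j).
Proof.
move=> LA k; apply: Ck_linear => //; first by move=> a x y; rewrite !mxE.
move=> x; apply: (@continuous_comp _ _ _ fst (fun y : 'M[R]_(m, n) => y i j)).
  exact: cvg_fst.
exact: coord_continuous.
Qed.

Lemma smooth_coord2 m n (E : normedModType R) (L A : set (E * 'M[R]_(m, n))) i j :
  rel_open L A -> smooth_real L A (fun x => x.2 i j).
Proof.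
move=> LA k; apply: Ck_linear => //; first by move=> a x y; rewrite !mxE.
move=> x; apply: (@continuous_comp _ _ _ snd (fun y : 'M[R]_(m, n) => y i j)).
  exact: cvg_snd.
exact: coord_continuous.
Qed.

Lemma rel_openI (E : normedModType R) (L O : set E) :
  linear_set L -> open O -> rel_open L (O `&` L).
Proof.
move=> [_ Llin] oO x v [Ox Lx] Lv.
have cx : (h *: v + x) @[h --> (0 : R)] --> x.
  rewrite -[X in _ --> X]add0r -(scale0r v).
  by apply: cvgD; [apply: cvgZr_tmp; exact: cvg_id|exact: cvg_cst].
have : \forall h \near (0 : R), O (h *: v + x).
  by apply: cx; apply: open_nbhs_nbhs.
by apply: filterS => h Oh; split => //; exact: Llin.
Qed.

Lemma rel_open_open (E : normedModType R) (O : set E) : open O -> rel_open setT O.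
Proof. by move=> oO; rewrite -(setIT O); exact: rel_openI. Qed.

Lemma rel_openX (E F : normedModType R) (L A : set E) (B : set F) :
  rel_open L A -> open B -> rel_open (L `*` setT) (A `*` B).
Proof.
move=> LA /rel_open_open oB [x y] [v w] [/= Ax By] [/= Lv _].
by near=> h; split => /=; near: h; [exact: LA|exact: oB].
Unshelve. all: by end_near. Qed.

Lemma continuous_mx_entries m n (T : topologicalType) (f : T -> 'M[R]_(m, n)) :
  entrywise (fun g : T -> R => continuous g) f -> continuous f.
Proof. by move=> cf x; apply: cvg_mx => i j; exact: cf. Qed.

Lemma continuous_ringD (T : topologicalType) (f g : T -> R) :
  continuous f -> continuous g -> continuous (fun x => f x + g x).
Proof. by move=> cf cg x; apply: cvgD; [exact: cf|exact: cg]. Qed.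

Lemma continuous_ringM (T : topologicalType) (f g : T -> R) :
  continuous f -> continuous g -> continuous (fun x => f x * g x).
Proof. by move=> cf cg x; apply: cvgM; [exact: cf|exact: cg]. Qed.

Lemma continuous_det n : continuous (fun A : 'M[R]_n => \det A).
Proof.
apply: (@closed_det _ _ (fun g : 'M[R]_n -> R => continuous g)).
- by move=> a; exact: cst_continuous.
- exact: continuous_ringD.
- exact: continuous_ringM.
- by move=> i j; exact: coord_continuous.
Qed.

Lemma open_GLplus n : open (@GLplus R n).
Proof.
by apply: (open_comp _ (@open_gt R 0)) => A _; exact: continuous_det.
Qed.

End Smoothness.

(** * Principal bundles from an equivariant frame *)

(** The base consists of the balls of radius 1/(k+1) around rational matrices: one that contains x
    and has radius below e/2 lies in the ball of radius e around x. *)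
Lemma second_countable_mx (R : realType) m n : @second_countable 'M[R]_(m, n).
Proof.
pose bq (qk : 'M[rat]_(m, n) * nat) : set 'M[R]_(m, n) :=
  ball (map_mx ratr qk.1 : 'M[R]_(m, n)) qk.2.+1%:R^-1.
exists (range bq).
  by apply: sub_countable (card_image_le _ _) _; exact: countableP.
split=> [_ [qk _ <-]|x U /nbhs_ballP[e /= e0 xeU]].
  by apply: ball_open; rewrite invr_gt0.
have [k ke] : exists k : nat, k.+1%:R^-1 < e / 2.
  exists (Num.truncn (e / 2)^-1).
  rewrite -[ltRHS]invrK ltf_pV2 ?posrE ?invr_gt0 ?divr_gt0 // ?ltr0n //.
  by apply: truncnS_gt.
have k0 : (0 : R) < k.+1%:R^-1 by rewrite invr_gt0.
have qP i j : exists q : rat, `|x i j - ratr q| < k.+1%:R^-1.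
  have [|q] := @rat_in_itvoo R (x i j - k.+1%:R^-1) (x i j + k.+1%:R^-1).
    by rewrite ltrBlDr -addrA ltrDl addr_gt0.
  by rewrite in_itv /= -ltr_distl distrC => ?; exists q.
pose q := \matrix_(i, j) sval (cid (qP i j)).
have xq : ball (map_mx ratr q : 'M[R]_(m, n)) k.+1%:R^-1 x.
  split=> // i j; rewrite !mxE /ball /= distrC.
  exact: (svalP (cid (qP i j))).
exists (bq (q, k)); first by split; [exists (q, k)|].
move=> y qy; apply: xeU; rewrite [e]splitr.
by apply: (@ball_triangle _ _ (map_mx ratr q : 'M[R]_(m, n)));
  apply: (le_ball (ltW ke)) => //; exact: ball_sym.
Qed.

Section PrincipalBundle.
Local Open Scope quotient_scope.
Context {R : realType} {m d : nat} {E : normedModType R}.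
(** [iota] parametrizes an affine slice by a vector space and [kappa] reads off the parameter; the
    slice may leave [N], so its frame is known to be 1 only where [iota y] lies in [N]. The matrix
    [D e] moves the slice to points whose frame determinant has the sign encoded by [e]. *)
Variables (act : 'M[R]_m -> E -> E) (L N O : set E) (F : E -> 'M[R]_m).
Variables (iota : 'rV[R]_d -> E) (kappa : E -> 'rV[R]_d) (D : bool -> 'M[R]_m).

Hypothesis act1 : forall x, act 1%:M x = x.
Hypothesis actM : forall g h x, g \in unitmx -> h \in unitmx ->
  act g (act h x) = act (h *m g) x.
Hypothesis linL : linear_set L.
Hypothesis oO : open O.
Hypothesis NE : N = O `&` L.
Hypothesis N_act : forall g x, g \in unitmx -> N x -> N (act g x).
Hypothesis F_unit : forall x, N x -> F x \in unitmx.
Hypothesis F_act : forall g x, g \in unitmx -> N x ->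
  F (act g x) = invmx g *m F x.
Hypothesis iotaK : cancel iota kappa.
Hypothesis L_iota : forall y, L (iota y).
Hypothesis F_iota : forall y, N (iota y) -> F (iota y) = 1%:M.
Hypothesis kappaK : forall x, N x -> F x = 1%:M -> iota (kappa x) = x.
Hypothesis detD : forall e, \det (D e) = if e then 1 else -1.
Hypothesis act_continuous : forall g, continuous (act g).
Hypothesis iota_continuous : continuous iota.
Hypothesis act_smooth :
  smooth_on (L `*` setT) (N `*` @GLplus R m) (fun xg => act xg.2 xg.1).
Hypothesis F_smooth : entrywise (smooth_real L N) F.
Hypothesis chart_smooth : smooth_on L N (fun x => kappa (act (F x) x)).
Hypothesis param_smooth : forall e,
  smooth_on setT ([set y | N (iota y)] `*` @GLplus R m)
    (fun yg : 'rV[R]_d * 'M[R]_m => act (D e *m yg.2) (iota yg.1)).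

Local Notation B := (orbit_space act N).
Local Notation pi := (@orbit_proj _ _ _ act N).

Lemma bundle_rel_open : rel_open L N.
Proof. by rewrite NE; exact: rel_openI. Qed.

Lemma frame_smooth (A : 'M[R]_m) :
  entrywise (smooth_real L N) (fun x => A *m invmx (F x)).
Proof.
have LN := bundle_rel_open; apply: entrywise_mul.
- exact: smooth_real_cst.
- exact: smooth_add.
- exact: smooth_mul.
- by apply: entrywise_cst; exact: smooth_real_cst.
- exact: smooth_invmx.
Qed.

Lemma GLplus_unit (g : 'M[R]_m) : GLplus g -> g \in unitmx.
Proof. by move=> g0; rewrite unitmxE unitfE gt_eqF. Qed.

Lemma GLplus_inv (g : 'M[R]_m) : GLplus g -> GLplus (invmx g).
Proof. by move=> g0; rewrite /GLplus /= det_inv invr_gt0. Qed.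

Lemma GLplus_mul (g h : 'M[R]_m) : GLplus g -> GLplus h -> GLplus (g *m h).
Proof. by move=> g0 h0; rewrite /GLplus /= det_mulmx mulr_gt0. Qed.

Lemma equivariant_frame_invariant : invariant_set act N.
Proof. by move=> g x /GLplus_unit gu; exact: N_act. Qed.

Lemma equivariant_frame_free : without_fixed_points act N.
Proof.
move=> x Nx; apply/seteqP; split=> [g [/GLplus_unit gu gx]|_ ->] /=; last first.
  by rewrite act1 /GLplus /= det1 ltr01.
have := F_act gu Nx; rewrite gx => /(congr1 (fun A => A *m invmx (F x))).
rewrite -mulmxA mulmxV ?F_unit // mulmx1 => /(congr1 (mulmx g)).
by rewrite mulmx1 mulmxV.
Qed.

(* The group element is recovered from the frames: g = F x (F (g x))^-1. *)
Lemma equivariant_frame_proper : proper_action act N.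
Proof.
move=> x g a b Nx g0 Na xa Nb gxb; exists id; split => //.
have gE n : g n = F (x n) *m invmx (F (act (g n) (x n))).
  have gu := GLplus_unit (g0 n).
  have := F_act gu (Nx n) => /(congr1 (mulmx (g n))); rewrite mulKVmx // => <-.
  by rewrite mulmxK // F_unit //; exact: N_act.
(* Continuity within [N] suffices along sequences that stay in [N] and converge to a point of
   [N]. *)
have within_cvg (f : E -> R) (u : nat -> E) c :
    smooth_real L N f -> (forall n, N (u n)) -> N c ->
    u n @[n --> \oo] --> c -> f (u n) @[n --> \oo] --> f c.
  move=> /(_ 0%N)/Ck_continuous/subspace_continuousP cf Nu Nc uc.
  apply: cvg_trans (cf _ Nc) => V cV.
  have {}cV : nbhs c [set y | N y -> V (f y)] := cV.
  have nV : \forall n \near \oo, N (u n) -> V (f (u n)) := uc _ cV.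
  by rewrite nbhs_simpl /=; apply: filterS nV => n; exact.
pose g1 := F a *m invmx (F b).
have gD : g n @[n --> \oo] --> g1.
  apply: cvg_mx => i j.
  rewrite (_ : (fun n => g n i j) = (fun n => \sum_k F (x n) i k *
    invmx (F (act (g n) (x n))) k j)); last first.
    by apply/funext => n; rewrite {1}gE mxE.
  rewrite /g1 mxE; apply: (cvg_big (@add_continuous R)) => k _; apply: cvgM.
    exact: (within_cvg (fun y => F y i k)).
  apply: (within_cvg (fun y => invmx (F y) k j)) => //.
    by apply: smooth_invmx => //; exact: bundle_rel_open.
  by move=> n; apply: N_act => //; exact: GLplus_unit.
exists g1; last exact: gD.
(* The limit of positive determinants is a priori only nonnegative; it is nonzero because [g1] is a
   product of invertible frames, taken at points of [N]. *)
have g1u : g1 \in unitmx by rewrite unitmx_mul unitmx_inv !F_unit.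
have : \det g1 != 0 by rewrite -unitfE -unitmxE.
rewrite neq_lt => /orP[|//] g1N.
have : \forall n \near \oo, \det (g n) < 0.
  apply: (cvgr_lt (\det g1)) => //.
  by apply: (cvg_comp _ _ gD); exact: continuous_det.
case/filter_ex => n gn; have := g0 n; rewrite /GLplus /= => /lt_trans/(_ gn).
by rewrite ltxx.
Qed.

Lemma set_typeP (x : N) : N (val x).
Proof. exact: set_valP. Qed.
Hint Resolve set_typeP : core.

Lemma orbit_projP (x y : N) :
  pi x = pi y <-> exists2 g, GLplus g & val y = act g (val x).
Proof.
have G1 : @GLplus R m 1%:M by rewrite /GLplus /= det1 ltr01.
split.
  move=> /eqmodP /asboolP xy.
  have : orbit_of act (val y) (val y) by exists 1%:M => //; rewrite act1.
  by rewrite -xy => -[g g0 gE]; exists g.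
move=> [g g0 yE]; apply/eqmodP/asboolP/seteqP; split=> _ [h h0 <-]; rewrite yE.
  exists (invmx g *m h); first exact: GLplus_mul (GLplus_inv g0) h0.
  rewrite actM ?unitmx_mul ?unitmx_inv ?GLplus_unit // mulmxA mulmxV ?mul1mx //.
  exact: GLplus_unit.
exists (g *m h); first exact: GLplus_mul.
by rewrite -actM ?GLplus_unit.
Qed.

Lemma orbit_proj_repr (b : B) : pi (repr b) = b.
Proof. exact: reprK. Qed.

Lemma orbit_proj_ind (P : B -> Prop) : (forall x, P (pi x)) -> forall b, P b.
Proof. by move=> Ppi b; rewrite -(orbit_proj_repr b). Qed.

(** By equivariance [act (F x) x] has frame (F x)^-1 F x = 1, so it is the point where the slice
    meets the orbit of x under all invertible matrices. That orbit splits into two orbits of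
    [GLplus], told apart by [frame_sign]. *)
Definition slice_coord (x : E) : 'rV[R]_d := kappa (act (F x) x).
Definition frame_sign (x : E) : bool := 0 < \det (F x).
Definition orbit_coord (b : B) := slice_coord (val (repr b)).
Definition orbit_sign (b : B) := frame_sign (val (repr b)).

Lemma slice_coord_act g x : g \in unitmx -> N x ->
  slice_coord (act g x) = slice_coord x.
Proof.
move=> gu Nx; rewrite /slice_coord F_act // actM //.
  by rewrite mulKVmx.
by rewrite unitmx_mul unitmx_inv gu F_unit.
Qed.

Lemma frame_sign_act g x : GLplus g -> N x -> frame_sign (act g x) = frame_sign x.
Proof.
move=> g0 Nx; rewrite /frame_sign F_act ?GLplus_unit // det_mulmx.
by rewrite pmulr_rgt0 //; exact: GLplus_inv.
Qed.

Lemma orbit_coord_proj x : orbit_coord (pi x) = slice_coord (val x).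
Proof.
have /orbit_projP[g g0 xE] := orbit_proj_repr (pi x).
rewrite /orbit_coord xE slice_coord_act ?GLplus_unit //.
Qed.

Lemma orbit_sign_proj x : orbit_sign (pi x) = frame_sign (val x).
Proof.
have /orbit_projP[g g0 xE] := orbit_proj_repr (pi x).
rewrite /orbit_sign xE frame_sign_act //.
Qed.

Lemma iota_slice x : N x -> iota (slice_coord x) = act (F x) x.
Proof.
move=> Nx; rewrite kappaK //; first by apply: N_act => //; exact: F_unit.
by rewrite F_act ?F_unit // mulVmx // F_unit.
Qed.

Lemma N_slice x : N x -> N (iota (slice_coord x)).
Proof. by move=> Nx; rewrite iota_slice //; apply: N_act => //; exact: F_unit. Qed.

(** Both points normalize to the same slice point, so F(x) F(y)^-1 carries x to y; equal signs make
    its determinant positive. *)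
Lemma orbit_proj_inj (x y : N) : slice_coord (val x) = slice_coord (val y) ->
  frame_sign (val x) = frame_sign (val y) -> pi x = pi y.
Proof.
move=> /(congr1 iota); rewrite !iota_slice // => xy sxy; apply/orbit_projP.
have Fxu := F_unit (set_typeP x); have Fyu := F_unit (set_typeP y).
exists (F (val x) *m invmx (F (val y))).
  move: sxy; rewrite /GLplus /= det_mulmx det_inv /frame_sign.
  move: Fxu Fyu; rewrite !unitmxE !unitfE.
  case: (ltrgt0P (\det (F (val x)))) => // x0 _; case: ltrgt0P => // y0 _ _.
    by rewrite mulr_gt0 ?invr_gt0.
  by rewrite nmulr_rgt0 ?invr_lt0.
rewrite -actM ?unitmx_inv // xy actM ?unitmx_inv // mulmxV //.
Qed.

Lemma orbit_proj_eq (x : N) (b : B) : slice_coord (val x) = orbit_coord b ->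
  frame_sign (val x) = orbit_sign b -> pi x = b.
Proof.
elim/orbit_proj_ind: b => z; rewrite orbit_coord_proj orbit_sign_proj.
exact: orbit_proj_inj.
Qed.

Lemma D_unit e : D e \in unitmx.
Proof. by rewrite unitmxE unitfE detD; case: e; rewrite ?oppr_eq0 oner_eq0. Qed.

Lemma slice_coord_iota y : N (iota y) -> slice_coord (iota y) = y.
Proof. by move=> Ny; rewrite /slice_coord F_iota // act1; exact: iotaK. Qed.

Lemma slice_coord_param e y : N (iota y) ->
  slice_coord (act (D e) (iota y)) = y.
Proof.
by move=> Ny; rewrite slice_coord_act ?D_unit // slice_coord_iota.
Qed.

Lemma frame_sign_param e y : N (iota y) ->
  frame_sign (act (D e) (iota y)) = e.
Proof.
move=> Ny; rewrite /frame_sign F_act ?D_unit // F_iota // mulmx1 det_inv detD.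
by rewrite invr_gt0; case: e; rewrite ?ltr01 // oppr_gt0 ltr10.
Qed.

Lemma open_slice_domain : open [set y | N (iota y)].
Proof.
rewrite (_ : [set y | _] = iota @^-1` O).
  by apply: open_comp => // y _; exact: iota_continuous.
by apply/seteqP; split=> y /=; rewrite NE; [case|split].
Qed.

Lemma within_continuous_val (T : topologicalType) (f : E -> T) :
  {within N, continuous f} -> continuous (fun x : N => f (val x)).
Proof. by move=> /subspace_sigL_continuousP. Qed.

Lemma orbit_coord_continuous : continuous orbit_coord.
Proof.
apply/quotient_continuous.
rewrite (_ : _ \o _ = (fun x : N => slice_coord (val x))); last first.
  by apply/funext => x; exact: orbit_coord_proj.
by apply: within_continuous_val; exact: Ck_continuous (chart_smooth 0).
Qed.

(** The determinant of the frame is continuous and vanishes nowhere on [N], so either sign is an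
    open condition. *)
Lemma open_orbit_sign e : open [set b | orbit_sign b = e].
Proof.
have cF : continuous (fun x : N => \det (F (val x))).
  apply: (@within_continuous_val _ (fun x => \det (F x))).
  apply: (@Ck_continuous _ _ L N R 0); move: 0%N.
  apply: (@closed_det _ _ (smooth_real L N)).
  - exact: (smooth_real_cst bundle_rel_open).
  - exact: (smooth_add bundle_rel_open).
  - exact: (smooth_mul bundle_rel_open).
  - exact: F_smooth.
change (open (pi @^-1` [set b | orbit_sign b = e])).
rewrite (_ : _ @^-1` _ = [set x : N | frame_sign (val x) = e]); last first.
  by apply/seteqP; split=> x /=; rewrite orbit_sign_proj.
case: e.
  by apply: (open_comp _ (@open_gt R 0)) => x _; exact: cF.
rewrite (_ : [set x | _] = [set x : N | \det (F (val x)) < 0]).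
  by apply: (open_comp _ (@open_lt R 0)) => x _; exact: cF.
apply/seteqP; split=> x /=; rewrite /frame_sign.
  by have := F_unit (set_typeP x); rewrite unitmxE unitfE; case: ltrgt0P.
by move=> x0; apply/negbTE; rewrite -leNgt ltW.
Qed.

(** A chart is described by a predicate instead of being constructed: [cinv] is a total function
    into the orbit space, which may be empty, and its values matter only where [iota y] lies in
    [N]. *)
Definition slice_chart (e : bool) (c : chart B d) : Prop :=
  [/\ cdom c = [set b | orbit_sign b = e], cmap c = orbit_coord &
      forall y, N (iota y) ->
        exists2 x : N, val x = act (D e) (iota y) & cinv c y = pi x].

Definition slice_atlas : set (chart B d) := [set c | exists e, slice_chart e c].

Lemma slice_chart_exists (b : B) : exists2 c, slice_atlas c & cdom c b.
Proof.
pose e := orbit_sign b.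
have Nparam y : N (iota y) -> act (D e) (iota y) \in N.
  by move=> Ny; apply/mem_set/N_act => //; exact: D_unit.
(* The given point [b] is the default value outside the image of the chart. *)
pose ci y : B := match pselect (N (iota y)) with
  | left Ny => pi (exist (fun x => x \in N) _ (Nparam y Ny))
  | right _ => b end.
exists (Chart [set b' | orbit_sign b' = e] orbit_coord ci) => //.
exists e; split=> // y Ny; rewrite /= /ci; case: pselect => // Ny'.
by exists (exist (fun x => x \in N) _ (Nparam y Ny')).
Qed.

(** Both signs give the same image, because [D e] brings any slice point in [N] to the sign [e]
    without changing its slice coordinate. *)
Lemma slice_chart_image e c : slice_chart e c ->
  [set cmap c b | b in cdom c] = [set y | N (iota y)].
Proof.
move=> [-> -> cinvE]; apply/seteqP; split=> [_ [b _ <-]|y Ny].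
  by elim/orbit_proj_ind: b => x; rewrite orbit_coord_proj; exact: N_slice.
have [x xE _] := cinvE y Ny; exists (pi x).
  by rewrite /= orbit_sign_proj xE frame_sign_param.
by rewrite orbit_coord_proj xE slice_coord_param.
Qed.

Lemma slice_chartK e c b : slice_chart e c -> cdom c b -> cinv c (cmap c b) = b.
Proof.
move=> [-> -> cinvE]; elim/orbit_proj_ind: b => x /=.
rewrite orbit_sign_proj orbit_coord_proj => xe.
have Ns := N_slice (set_typeP x).
have [z zE ->] := cinvE _ Ns; apply: orbit_proj_inj.
  by rewrite zE slice_coord_param.
by rewrite zE frame_sign_param.
Qed.

Lemma slice_chart_inv e c y : slice_chart e c -> N (iota y) ->
  cdom c (cinv c y) /\ cmap c (cinv c y) = y.
Proof.
move=> [-> -> cinvE] Ny; have [x xE ->] := cinvE y Ny; split.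
  by rewrite /= orbit_sign_proj xE frame_sign_param.
by rewrite orbit_coord_proj xE slice_coord_param.
Qed.

(** Where it matters, [cinv c y] is the orbit of [act (D e) (iota y)]. The preimage of [U] in [N] is
    the trace of an open set [W] of [E], which reduces the claim to continuity of a map with values
    in [E]. *)
Lemma slice_chart_inv_continuous e c y (U : set B) : slice_chart e c ->
  N (iota y) -> open U -> U (cinv c y) ->
  \forall y' \near y, U (cinv c y').
Proof.
move=> [_ _ cinvE] Ny oU Uy.
have [W oW WU] : wopen (set_val : N -> E) (pi @^-1` U) by exact: oU.
have cp : continuous (fun y => act (D e) (iota y)).
  by move=> z; apply: continuous_comp; [exact: iota_continuous|exact: act_continuous].
have [x xE cxE] := cinvE y Ny.
have Wx : W (act (D e) (iota y)).
  by rewrite -xE; change ((set_val @^-1` W) x); rewrite WU /= -cxE.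
have nW : \forall y' \near y, W (act (D e) (iota y')).
  by apply: cp; exact: open_nbhs_nbhs.
have nV : \forall y' \near y, N (iota y').
  by apply: (@open_nbhs_nbhs _ y [set y | N (iota y)]); split => //;
    exact: open_slice_domain.
near=> z.
have Nz : N (iota z) by near: z.
have [x' x'E ->] := cinvE z Nz.
change ((pi @^-1` U) x'); rewrite -WU.
change (W (val x')); rewrite x'E; near: z; exact: nW.
Unshelve. all: by end_near. Qed.

Lemma slice_chart_is_chart e c : slice_chart e c -> is_chart c.
Proof.
move=> ce; have [dE mE _] := ce; split.
- by rewrite dE; exact: open_orbit_sign.
- by rewrite (slice_chart_image ce); exact: open_slice_domain.
- by move=> b; exact: slice_chartK ce.
- by rewrite mE; apply: continuous_subspaceT; exact: orbit_coord_continuous.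
- rewrite (slice_chart_image ce); apply/subspace_continuousP => y Ny U.
  rewrite nbhsE => -[U' [oU' U'y] U'U].
  have nU := slice_chart_inv_continuous ce Ny oU' U'y.
  by apply: filterS nU => z U'z _; exact: U'U.
Qed.

(** Charts of equal sign share the coordinate [orbit_coord], so their transition map is the
    identity; charts of opposite sign do not overlap. *)
Lemma slice_atlas_smooth : smooth_atlas slice_atlas.
Proof.
split; first by move=> c [e]; exact: slice_chart_is_chart.
  exact: slice_chart_exists.
move=> c1 c2 [e1 ce1] [e2 ce2].
have [d1 m1 _] := ce1; have [d2 m2 _] := ce2.
case: (eqVneq e1 e2) => [ee|ne]; last first.
  have -> : [set cmap c1 b | b in cdom c1 `&` cdom c2] = set0.
    apply/seteqP; split=> // y [b [+ +] _]; rewrite d1 d2 /= => b1 b2.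
    by move: ne; rewrite -b1 b2 eqxx.
  exact: smooth_set0.
rewrite d1 d2 ee setIid -ee -d1 (slice_chart_image ce1).
have Vo := rel_open_open open_slice_domain.
apply: (@eq_smooth _ _ _ _ Vo _ id) => [y Ny|].
  by have [_] := slice_chart_inv ce1 Ny; rewrite m1 m2 => ->.
apply: smooth_mx => // i j; exact: smooth_coord.
Qed.

(** Two points that cannot be separated have the same coordinate, row vectors being Hausdorff, and
    the same sign, signs being open conditions; together these determine the orbit. *)
Lemma orbit_space_hausdorff : hausdorff_space B.
Proof.
move=> p q cpq.
have cpq' : orbit_coord p = orbit_coord q.
  apply: norm_hausdorff => U V Up Vq.
  have [z [Uz Vz]] := cpq _ _ (orbit_coord_continuous Up) (orbit_coord_continuous Vq).
  by exists (orbit_coord z).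
have spq : orbit_sign p = orbit_sign q.
  apply/eqP; apply: contrapT => /negP npq.
  have Up : nbhs p [set b | orbit_sign b = orbit_sign p].
    by apply: open_nbhs_nbhs; split => //; exact: open_orbit_sign.
  have Uq : nbhs q [set b | orbit_sign b = orbit_sign q].
    by apply: open_nbhs_nbhs; split => //; exact: open_orbit_sign.
  have [z [/= zp zq]] := cpq _ _ Up Uq.
  by move: npq; rewrite -zp zq eqxx.
move: cpq' spq; elim/orbit_proj_ind: p {cpq} => x; elim/orbit_proj_ind: q => y.
by rewrite !orbit_coord_proj !orbit_sign_proj; exact: orbit_proj_inj.
Qed.

(** A countable base of the coordinate space is pulled back along [orbit_coord] and cut by each of
    the two signs. *)
Lemma orbit_space_second_countable : @second_countable B.
Proof.
have [K cK [oK bK]] := second_countable_mx R 1 d.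
pose W (eU : bool * set 'rV[R]_d) : set B :=
  [set b | orbit_sign b = eU.1 /\ eU.2 (orbit_coord b)].
exists (W @` (setT `*` K)).
  by apply: sub_countable (card_image_le _ _) (countableX (countableP _) cK).
have oW eU : K eU.2 -> open (W eU).
  move=> KU; apply: openI; first exact: open_orbit_sign.
  by apply: open_comp => [x _|]; [exact: orbit_coord_continuous|exact: oK].
split=> [_ [eU [_ KU] <-]|b A]; first exact: oW.
rewrite nbhsE => -[A' [oA' A'b] A'A].
have [c [e ce] cb] := slice_chart_exists b.
have [dE mE _] := ce.
have be : orbit_sign b = e by move: cb; rewrite dE.
have Nb : N (iota (orbit_coord b)).
  by elim/orbit_proj_ind: (b) => x; rewrite orbit_coord_proj; exact: N_slice.
have A'b' : A' (cinv c (orbit_coord b)) by rewrite -mE (slice_chartK ce).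
have [U [KU Ub] UA] := bK _ _ (slice_chart_inv_continuous ce Nb oA' A'b').
exists (W (e, U)); first by split; [exists (e, U)|].
move=> b' [/= b'e b'U]; apply: A'A.
have := UA _ b'U; rewrite /= -mE (slice_chartK ce) //.
by rewrite dE.
Qed.

Theorem equivariant_frame_bundle :
  smooth_principal_bundle act L (@orbit_proj _ _ _ act N) slice_atlas.
Proof.
split; first by exists O.
split; first by split; [exact: orbit_space_hausdorff|
  exact: orbit_space_second_countable|exact: slice_atlas_smooth].
split; first exact: act_smooth.
split; first by move=> b; exists (repr b); exact: orbit_proj_repr.
split; first exact: orbit_projP.
split.
  move=> c [e [-> -> _]]; exists slice_coord.
    by move=> x _; rewrite orbit_coord_proj.
  by apply: smooth_subset chart_smooth => _ [x _ <-].
move=> b; pose e := orbit_sign b.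
have LN := bundle_rel_open.
have De := D_unit e.
pose rep (b' : B) := iota (orbit_coord b').
(* For x = [act (D e *m g) (iota y)] the frame is (D e g)^-1, whence g = (D e)^-1 F(x)^-1. *)
exists [set b' | orbit_sign b' = e], (fun x => invmx (D e) *m invmx (F x)),
  (fun b' g => act (D e *m g) (rep b')).
have Nrep b' : N (rep b').
  by elim/orbit_proj_ind: b' => x; rewrite /rep orbit_coord_proj; exact: N_slice.
split=> //; first exact: open_orbit_sign.
have phi_act x g : N x -> g \in unitmx ->
    invmx (D e) *m invmx (F (act g x)) = invmx (D e) *m invmx (F x) *m g.
  move=> Nx gu; rewrite F_act // -mulmxA; congr (_ *m _).
  have Fxu := F_unit Nx; have FgU := F_unit (N_act gu Nx).
  rewrite F_act // in FgU.
  apply: (can_inj (mulKmx FgU)); rewrite mulmxV // -mulmxA mulKVmx //.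
  by rewrite mulVmx.
split.
- move=> x /=; rewrite orbit_sign_proj => xe.
  have Fxu := F_unit (set_typeP x).
  split.
    move: xe; rewrite /GLplus /= det_mulmx !det_inv detD /frame_sign.
    move: Fxu; rewrite unitmxE unitfE; case: (e); case: (ltrgt0P (\det _)) => // x0 _ _.
      by rewrite invr1 mul1r invr_gt0.
    by rewrite invrN1 mulN1r oppr_gt0 invr_lt0.
  rewrite /rep orbit_coord_proj iota_slice // actM ?unitmx_mul ?unitmx_inv ?De //.
  by rewrite mulKVmx // mulmxV.
- move=> b' g be' g0; have gu := GLplus_unit g0.
  have xN : act (D e *m g) (rep b') \in N.
    by apply/mem_set/N_act; rewrite ?unitmx_mul ?De.
  exists (exist (fun x => x \in N) _ xN); split => //=.
    apply: orbit_proj_eq => /=.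
      rewrite slice_coord_act ?unitmx_mul ?De // slice_coord_iota //.
      exact: Nrep.
    rewrite -actM // frame_sign_act //; last exact: N_act.
    by rewrite frame_sign_param ?be' //; exact: Nrep.
  rewrite phi_act ?unitmx_mul ?De // [F (rep b')]F_iota; last exact: Nrep.
  by rewrite invmx1 mulmx1 mulKmx.
- move=> x g _ g0; rewrite phi_act //; exact: GLplus_unit.
- apply: (smooth_subset (B := N)); first by move=> _ [x _ <-].
  by apply: smooth_mx => //; exact: frame_smooth.
- move=> c [e' ce]; have [dE mE cinvE] := ce.
  have [ee|ne] := eqVneq e e'; last first.
    have -> : [set cmap c b' | b' in [set b' | orbit_sign b' = e] `&` cdom c] = set0.
      apply/seteqP; split=> // y [b' [/= b1 +] _]; rewrite dE /= => b2.
      by move: ne; rewrite -b1 b2 eqxx.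
    by rewrite set0X; exact: smooth_set0.
  rewrite ee -dE setIid (slice_chart_image ce).
  have Wo : rel_open setT ([set y | N (iota y)] `*` @GLplus R m).
    rewrite -setXTT; apply: rel_openX; last exact: open_GLplus.
    by apply: rel_open_open; exact: open_slice_domain.
  apply: (eq_smooth Wo) (@param_smooth e') => -[y g] [/= Ny g0].
  by have [_] := slice_chart_inv ce Ny; rewrite mE /rep => ->.
Qed.

End PrincipalBundle.

(** * The algebra of constant Christoffel symbols *)

Section ChristoffelAlgebra.
Context {R : realType} {m : nat}.
Implicit Types (G H : 'M[R]_(m * m, m)) (T : 'M[R]_m) (x y : 'cV[R]_m).

Local Notation e i := (delta_mx i 0 : 'cV[R]_m).

Definition cmul G x y : 'cV[R]_m :=
  \col_k \sum_i \sum_j x i 0 * y j 0 * chr G i j k.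

Definition Lmx G x : 'M[R]_m := \matrix_(k, j) \sum_i x i 0 * chr G i j k.

Definition Rmx G y : 'M[R]_m := \matrix_(k, i) \sum_j y j 0 * chr G i j k.

Lemma Lmx_mul G x y : Lmx G x *m y = cmul G x y.
Proof.
apply/colP => k; rewrite !mxE exchange_big /=; apply: eq_bigr => j _.
by rewrite mxE mulr_suml; apply: eq_bigr => i _; rewrite mulrAC.
Qed.

Lemma Rmx_mul G x y : Rmx G y *m x = cmul G x y.
Proof.
apply/colP => k; rewrite !mxE; apply: eq_bigr => i _.
by rewrite mxE mulr_suml; apply: eq_bigr => j _; rewrite mulrAC [x _ _ * _]mulrC.
Qed.

Lemma Lmx_linear G (a : R) x y : Lmx G (a *: x + y) = a *: Lmx G x + Lmx G y.
Proof.
apply/matrixP => k j; rewrite !mxE mulr_sumr -big_split /=.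
by apply: eq_bigr => i _; rewrite !mxE mulrDl mulrA.
Qed.

Lemma Rmx_linear G (a : R) x y : Rmx G (a *: x + y) = a *: Rmx G x + Rmx G y.
Proof.
apply/matrixP => k j; rewrite !mxE mulr_sumr -big_split /=.
by apply: eq_bigr => i _; rewrite !mxE mulrDl mulrA.
Qed.

Lemma mx_eq_on_basis p (A B : 'M[R]_(p, m)) :
  (forall j, A *m e j = B *m e j) -> A = B.
Proof.
move=> AB; apply/matrixP => i j.
by have /colP/(_ i) := AB j; rewrite -!colE !mxE.
Qed.

Lemma chrE G i j k : chr G i j k = cmul G (e i) (e j) k 0.
Proof.
rewrite -Lmx_mul -colE !mxE (bigD1 i) //= !mxE !eqxx mul1r big1 ?addr0 // => l li.
by rewrite !mxE (negbTE li) mul0r.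
Qed.

Lemma chr_ext G H : (forall i j k, chr G i j k = chr H i j k) -> G = H.
Proof. by move=> GH; apply/matrixP => r k; case/mxvec_indexP: r => i j; exact: GH. Qed.

Lemma chr_mk f i j k : chr (mk_chr f : 'M[R]_(m * m, m)) i j k = f i j k.
Proof. by rewrite /chr /mk_chr !mxE mxvecE mxE. Qed.

Lemma cmul_ext G H : (forall i j, cmul G (e i) (e j) = cmul H (e i) (e j)) -> G = H.
Proof. by move=> GH; apply: chr_ext => i j k; rewrite !chrE GH. Qed.

Lemma chr_formE G x y (w : 'rV[R]_m) : chr_form G x y w = (w *m cmul G x y) 0 0.
Proof.
rewrite /chr_form mxE.
under [RHS]eq_bigr do rewrite mxE mulr_sumr.
rewrite [RHS]exchange_big /=; apply: eq_bigr => i _.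
under [RHS]eq_bigr do rewrite mulr_sumr.
rewrite [RHS]exchange_big /=; apply: eq_bigr => j _; apply: eq_bigr => k _.
by rewrite mulrAC mulrC mulrA.
Qed.

(** For invertible [T] this says that [T] is an isomorphism from the algebra of [chr_act T G] to
    that of [G]. It is read off on basis vectors and extended one argument at a time, through the
    matrices of left and right multiplication. *)
Lemma cmul_act T G x y :
  cmul (chr_act T G) x y = invmx T *m cmul G (T *m x) (T *m y).
Proof.
have basis i j :
    cmul (chr_act T G) (e i) (e j) = invmx T *m cmul G (T *m e i) (T *m e j).
  apply/colP => k; rewrite -chrE chr_mk chr_formE -!colE.
  by rewrite -row_mul [in LHS]mxE.
have left i z : cmul (chr_act T G) (e i) z = invmx T *m cmul G (T *m e i) (T *m z).
  rewrite -!Lmx_mul !mulmxA; congr (_ *m _); apply: mx_eq_on_basis => j.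
  by rewrite Lmx_mul basis -Lmx_mul !mulmxA.
rewrite -!Rmx_mul !mulmxA; congr (_ *m _); apply: mx_eq_on_basis => i.
by rewrite Rmx_mul left -Rmx_mul !mulmxA.
Qed.

Lemma Lmx_act T G x : Lmx (chr_act T G) x = invmx T *m Lmx G (T *m x) *m T.
Proof.
by apply: mx_eq_on_basis => j; rewrite -!mulmxA !Lmx_mul cmul_act.
Qed.

Lemma Rmx_act T G x : Rmx (chr_act T G) x = invmx T *m Rmx G (T *m x) *m T.
Proof.
by apply: mx_eq_on_basis => j; rewrite -!mulmxA !Rmx_mul cmul_act.
Qed.

Lemma chr_act1 G : chr_act 1%:M G = G.
Proof. by apply: cmul_ext => i j; rewrite cmul_act invmx1 !mul1mx. Qed.

Lemma invmx_mul (A B : 'M[R]_m) : A \in unitmx -> B \in unitmx ->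
  invmx (A *m B) = invmx B *m invmx A.
Proof.
move=> Au Bu; have ABu : A *m B \in unitmx by rewrite unitmx_mul Au.
apply: (can_inj (mulKmx ABu)); rewrite mulmxV // mulmxA -(mulmxA A) mulmxV //.
by rewrite mulmx1 mulmxV.
Qed.

Lemma chr_actM S T G : S \in unitmx -> T \in unitmx ->
  chr_act S (chr_act T G) = chr_act (T *m S) G.
Proof.
move=> Su Tu; apply: cmul_ext => i j.
by rewrite !cmul_act invmx_mul // !mulmxA.
Qed.

Lemma torsion_free_act T G : torsion_free G -> torsion_free (chr_act T G).
Proof.
move=> tG i j k; rewrite !chrE !cmul_act; congr ((_ *m _) k 0).
apply/colP => l; rewrite !mxE exchange_big /=; apply: eq_bigr => a _.
by apply: eq_bigr => b _; rewrite tG [X in X * _]mulrC.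
Qed.

Lemma mxtrace_conj T (A : 'M[R]_m) : T \in unitmx -> \tr (invmx T *m A *m T) = \tr A.
Proof. by move=> Tu; rewrite mxtrace_mulC mulmxA mulmxV // mul1mx. Qed.

(** The Ricci tensor without indices: left and right multiplications are conjugated by the action,
    so traces of their products are visibly equivariant. *)
Definition ricci_form G x y : R := \tr (Rmx G (cmul G x y)) - \tr (Lmx G x *m Rmx G y).

Lemma Lmx_basis G i k j : Lmx G (e i) k j = chr G i j k.
Proof. by rewrite chrE -Lmx_mul -colE [RHS]mxE. Qed.

Lemma Rmx_basis G j k i : Rmx G (e j) k i = chr G i j k.
Proof. by rewrite chrE -Rmx_mul -colE [RHS]mxE. Qed.

Lemma ricciE G i j : ricci G i j = ricci_form G (e i) (e j).
Proof.
rewrite /ricci_form /mxtrace mxE -sumrB; apply: eq_bigr => a _.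
rewrite [Rmx _ _ _ _]mxE [(_ *m _) _ _]mxE -sumrB; apply: eq_bigr => b _.
by rewrite -chrE Lmx_basis Rmx_basis [X in X - _]mulrC.
Qed.

Lemma ricci_form_act T G x y : T \in unitmx ->
  ricci_form (chr_act T G) x y = ricci_form G (T *m x) (T *m y).
Proof.
move=> Tu; rewrite /ricci_form !Rmx_act Lmx_act cmul_act mulKVmx //.
rewrite mxtrace_conj // !mulmxA mulmxK // -[invmx T *m _ *m _]mulmxA.
by rewrite mxtrace_conj.
Qed.

Lemma bilinear_form_mx (f : 'cV[R]_m -> 'cV[R]_m -> R) T i j :
  (forall (a : R) x x' y, f (a *: x + x') y = a * f x y + f x' y) ->
  (forall (a : R) x y y', f x (a *: y + y') = a * f x y + f x y') ->
  f (T *m e i) (T *m e j) = (T^T *m (\matrix_(k, l) f (e k) (e l)) *m T) i j.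
Proof.
move=> fl fr.
have colsum k : T *m e k = \sum_l T l k *: e l.
  apply/colP => a; rewrite -colE mxE summxE (bigD1 a) //= !mxE !eqxx mulr1.
  by rewrite big1 ?addr0 // => l la; rewrite !mxE eq_sym (negbTE la) mulr0.
have f0l y : f 0 y = 0.
  have := fl 0 0 0 y; rewrite scale0r add0r mul0r add0r.
  have := fl 1 0 0 y; rewrite scaler0 add0r mul1r => h _.
  by apply: (@addrI _ (f 0 y)); rewrite addr0 -h.
have f0r y : f y 0 = 0.
  have := fr 1 y 0 0; rewrite scaler0 add0r mul1r => h.
  by apply: (@addrI _ (f y 0)); rewrite addr0 -h.
have suml y (r : seq 'I_m) : f (\sum_(l <- r) T l i *: e l) y =
    \sum_(l <- r) T l i * f (e l) y.
  by elim: r => [|l r IH]; rewrite ?big_nil // !big_cons fl IH.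
have sumr y (r : seq 'I_m) : f y (\sum_(l <- r) T l j *: e l) =
    \sum_(l <- r) T l j * f y (e l).
  by elim: r => [|l r IH]; rewrite ?big_nil // !big_cons fr IH.
rewrite !colsum sumr mxE; apply: eq_bigr => l _.
rewrite suml mulrC mxE; congr (_ * _); apply: eq_bigr => k _.
by rewrite !mxE.
Qed.

Lemma ricci_act T G : T \in unitmx ->
  ricci (chr_act T G) = T^T *m ricci G *m T.
Proof.
move=> Tu; apply/matrixP => i j; rewrite ricciE ricci_form_act //.
rewrite bilinear_form_mx /ricci_form.
- congr ((_ *m _ *m _) i j); apply/matrixP => k l.
  by rewrite ricciE mxE.
- move=> a x x' y; rewrite -!Rmx_mul mulmxDr -scalemxAr Rmx_linear Lmx_linear.
  rewrite mulmxDl -scalemxAl !mxtraceD !mxtraceZ mulrBr opprD !addrA.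
  by rewrite -!addrA; congr (_ + _); rewrite addrCA.
- move=> a x y y'; rewrite -!Lmx_mul mulmxDr -scalemxAr !Rmx_linear.
  rewrite mulmxDr -scalemxAr !mxtraceD !mxtraceZ mulrBr opprD !addrA.
  by rewrite -!addrA; congr (_ + _); rewrite addrCA.
Qed.

Lemma ricci_sE G : ricci_s G = 2^-1 *: (ricci G + (ricci G)^T).
Proof. by apply/matrixP => j k; rewrite !mxE. Qed.

Lemma ricci_s_tr G : (ricci_s G)^T = ricci_s G.
Proof. by rewrite ricci_sE linearZ /= linearD /= trmxK addrC. Qed.

Lemma ricci_s_act T G : T \in unitmx ->
  ricci_s (chr_act T G) = T^T *m ricci_s G *m T.
Proof.
move=> Tu; rewrite !ricci_sE ricci_act // !trmx_mul trmxK.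
by rewrite -scalemxAr -scalemxAl mulmxDr mulmxDl !mulmxA.
Qed.

Lemma has_signature_congr p q T (S : 'M[R]_m) : T \in unitmx ->
  has_signature p q S -> has_signature p q (T^T *m S *m T).
Proof.
move=> Tu [pq [B Bu BSB]]; split => //; exists (invmx T *m B).
  by rewrite unitmx_mul unitmx_inv Tu.
by rewrite trmx_mul trmx_inv !mulmxA mulmxKV ?unitmx_tr // mulmxK.
Qed.

(** [trace_covector], [trace_form] and [trace_vector] are w, b and v of the overview. With torsion b
    may fail to be symmetric, so it matters that v fills the left slot. *)
Definition trace_covector G : 'rV[R]_m := \row_j \tr (Lmx G (e j)).

Definition trace_form G : 'M[R]_m :=
  \matrix_(i, j) (trace_covector G *m cmul G (e i) (e j)) 0 0.

Definition trace_vector G : 'cV[R]_m :=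
  (trace_covector G *m invmx (trace_form G))^T.

Definition krylov G x k : 'cV[R]_m := iter k (cmul G x) x.

Definition krylov_mx G x : 'M[R]_m := \matrix_(i, k) krylov G x k i 0.

Definition frame G : 'M[R]_m := krylov_mx G (trace_vector G).

Lemma mul_tr_covector G x : trace_covector G *m x = (\tr (Lmx G x))%:M.
Proof.
apply/rowP => i; rewrite [i]ord1 [RHS]mxE eqxx mulr1n [LHS]mxE /mxtrace.
under eq_bigr do rewrite mxE mulr_suml.
rewrite exchange_big /=; apply: eq_bigr => k _.
rewrite [RHS]mxE; apply: eq_bigr => l _.
by rewrite Lmx_basis mulrC.
Qed.

Lemma trace_covector_act T G : T \in unitmx ->
  trace_covector (chr_act T G) = trace_covector G *m T.
Proof.
move=> Tu; apply: mx_eq_on_basis => j.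
by rewrite -mulmxA !mul_tr_covector Lmx_act mxtrace_conj.
Qed.

Lemma mul_trace_form G x : x^T *m trace_form G = trace_covector G *m Lmx G x.
Proof.
have colE' j : trace_form G *m e j = (trace_covector G *m Rmx G (e j))^T.
  apply/colP => i; rewrite -colE [LHS]mxE [LHS]mxE [RHS]mxE -Rmx_mul mulmxA.
  by rewrite -colE mxE.
apply: mx_eq_on_basis => j; rewrite -!mulmxA colE' Lmx_mul -Rmx_mul -trmx_mul.
by rewrite mulmxA; apply/rowP => i; rewrite [i]ord1 mxE.
Qed.

(** As b(x, _) is the covector w L_x, the vector v is the only x with w L_x = w. This inverse-free
    description yields both the equivariance of v and the slice equations. *)
Lemma trace_vectorP G x : trace_form G \in unitmx ->
  trace_covector G *m Lmx G x = trace_covector G <-> x = trace_vector G.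
Proof.
move=> Bu; rewrite -mul_trace_form /trace_vector; split=> [<-|->].
  by rewrite mulmxK // trmxK.
by rewrite trmxK mulmxKV.
Qed.

Lemma trace_form_act T G : T \in unitmx ->
  trace_form (chr_act T G) = T^T *m trace_form G *m T.
Proof.
move=> Tu; suff h x : x^T *m trace_form (chr_act T G) =
    x^T *m (T^T *m trace_form G *m T).
  apply: (can_inj (@trmxK _ _ _)); apply: mx_eq_on_basis => j.
  by apply: (can_inj (@trmxK _ _ _)); rewrite !trmx_mul !trmxK h.
rewrite mul_trace_form trace_covector_act // Lmx_act !mulmxA mulmxK //.
by rewrite -mul_trace_form trmx_mul.
Qed.

Lemma trace_form_act_unit T G : T \in unitmx -> trace_form G \in unitmx ->
  trace_form (chr_act T G) \in unitmx.
Proof. by move=> Tu Bu; rewrite trace_form_act // !unitmx_mul unitmx_tr Tu Bu. Qed.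

Lemma trace_vector_act T G : T \in unitmx -> trace_form G \in unitmx ->
  trace_vector (chr_act T G) = invmx T *m trace_vector G.
Proof.
move=> Tu Bu; apply/esym/trace_vectorP; first exact: trace_form_act_unit.
rewrite trace_covector_act // Lmx_act mulKVmx // !mulmxA mulmxK //.
by rewrite (trace_vectorP (trace_vector G) Bu).2.
Qed.

Lemma krylov_act T G x k : T \in unitmx ->
  krylov (chr_act T G) (invmx T *m x) k = invmx T *m krylov G x k.
Proof.
move=> Tu; elim: k => [//|k IH].
by rewrite /krylov !iterS -!/(krylov _ _ k) IH cmul_act !mulKVmx.
Qed.

Lemma mul_krylov_mx G x k : krylov_mx G x *m e k = krylov G x k.
Proof. by rewrite -colE; apply/colP => i; rewrite !mxE. Qed.

Lemma frame_act T G : T \in unitmx -> trace_form G \in unitmx ->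
  frame (chr_act T G) = invmx T *m frame G.
Proof.
move=> Tu Bu; apply: mx_eq_on_basis => k.
by rewrite -mulmxA !mul_krylov_mx trace_vector_act // krylov_act.
Qed.

(* The denominator-free frame, polynomial in the Christoffel symbols: its k-th
   column is [det (trace_form G) ^ (k + 1)] times that of [frame G]. *)
Definition poly_frame G : 'M[R]_m :=
  krylov_mx G (trace_covector G *m \adj (trace_form G))^T.

Lemma krylovZ G (a : R) x k : krylov G (a *: x) k = a ^+ k.+1 *: krylov G x k.
Proof.
elim: k => [|k IH]; first by rewrite expr1.
rewrite /krylov !iterS -!/(krylov _ _ k) IH -!Lmx_mul.
rewrite -[a *: x]addr0 Lmx_linear.
have -> : Lmx G 0 = 0.
  by apply/matrixP => i j; rewrite !mxE big1 // => l _; rewrite mxE mul0r.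
by rewrite addr0 -scalemxAl -scalemxAr scalerA -exprS.
Qed.

Lemma det_poly_frame G : trace_form G \in unitmx ->
  (\det (poly_frame G) != 0) = (frame G \in unitmx).
Proof.
move=> Bu; have d0 : \det (trace_form G) != 0 by rewrite -unitfE -unitmxE.
have -> : poly_frame G =
    frame G *m diag_mx (\row_k \det (trace_form G) ^+ k.+1).
  apply/matrixP => i k; rewrite mul_mx_diag !mxE /poly_frame.
  rewrite (_ : (trace_covector G *m \adj (trace_form G))^T =
      \det (trace_form G) *: trace_vector G).
    by rewrite krylovZ mxE mulrC.
  by rewrite /trace_vector /invmx Bu -scalemxAr linearZ /= scalerA divff // scale1r.
rewrite det_mulmx det_diag mulf_eq0 negb_or unitmxE unitfE andbC.
have -> // : \prod_i (\row_(k < m) \det (trace_form G) ^+ k.+1) 0 i != 0.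
by apply/prodf_neq0 => i _; rewrite mxE expf_neq0.
Qed.

(** The Ricci factor gives the required divisibility, the other two the existence and independence
    of the frame. [poly_frame] stands in for [frame], whose entries are only rational. *)
Definition moduli_poly G : R :=
  \det (ricci_s G) * (\det (trace_form G) * \det (poly_frame G)).

Lemma moduli_poly_neq0 G : moduli_poly G != 0 <->
  [/\ \det (ricci_s G) != 0, trace_form G \in unitmx & frame G \in unitmx].
Proof.
rewrite /moduli_poly !mulf_eq0 !negb_or; split.
  move=> /and3P[r0 b0 f0].
  have Bu : trace_form G \in unitmx by rewrite unitmxE unitfE.
  by rewrite -det_poly_frame.
move=> [-> Bu Fu]; rewrite det_poly_frame // Fu andbT /=.
by rewrite -unitfE -unitmxE.
Qed.

Lemma moduli_poly_act T G : T \in unitmx ->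
  moduli_poly G != 0 -> moduli_poly (chr_act T G) != 0.
Proof.
move=> Tu /moduli_poly_neq0[r0 Bu Fu]; apply/moduli_poly_neq0; split.
- rewrite ricci_s_act // !det_mulmx det_tr !mulf_neq0 // -unitfE -unitmxE //.
- exact: trace_form_act_unit.
- by rewrite frame_act // unitmx_mul unitmx_inv Tu.
Qed.

End ChristoffelAlgebra.

(** * Polynomial and rational dependence on the Christoffel symbols *)

Section ClosedChristoffel.
Context {R : realType} {m : nat} {T : Type} (C : (T -> R) -> Prop).
Hypothesis C_cst : forall a, C (fun=> a).
Hypothesis C_add : forall f g, C f -> C g -> C (fun x => f x + g x).
Hypothesis C_mul : forall f g, C f -> C g -> C (fun x => f x * g x).

Let C_sum := closed_sum C_cst C_add.

Let C_mulmx (p q r : nat) (f : T -> 'M[R]_(p, q)) (g : T -> 'M[R]_(q, r)) :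
    entrywise C f -> entrywise C g -> entrywise C (fun x => f x *m g x) :=
  @entrywise_mul T R C C_cst C_add C_mul p q r f g.

Let C_eq f g : C f -> f =1 g -> C g.
Proof. by move=> Cf /funext <-. Qed.

Context (G : T -> 'M[R]_(m * m, m)).
Hypothesis C_G : entrywise C G.

Lemma entrywise_Lmx (x : T -> 'cV[R]_m) :
  entrywise C x -> entrywise C (fun t => Lmx (G t) (x t)).
Proof.
move=> Cx k j; apply: (C_eq (f := fun t => \sum_i x t i 0 * chr (G t) i j k)).
  by apply: C_sum => i; apply: C_mul; [exact: Cx|exact: C_G].
by move=> t; rewrite mxE.
Qed.

Lemma entrywise_cmul (x y : T -> 'cV[R]_m) :
  entrywise C x -> entrywise C y -> entrywise C (fun t => cmul (G t) (x t) (y t)).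
Proof.
move=> Cx Cy i j; apply: (C_eq (f := fun t => (Lmx (G t) (x t) *m y t) i j)).
  by apply: C_mulmx => //; exact: entrywise_Lmx.
by move=> t; rewrite Lmx_mul.
Qed.

Lemma entrywise_trace_covector : entrywise C (fun t => trace_covector (G t)).
Proof.
move=> i j; apply: (C_eq (f := fun t => \sum_k Lmx (G t) (delta_mx j 0) k k)).
  apply: C_sum => k; apply: entrywise_Lmx; exact: entrywise_cst.
by move=> t; rewrite mxE.
Qed.

Lemma entrywise_trace_form : entrywise C (fun t => trace_form (G t)).
Proof.
move=> i j; apply: (C_eq (f := fun t => (trace_covector (G t) *m
    cmul (G t) (delta_mx i 0) (delta_mx j 0)) 0 0)).
  apply: C_mulmx; first exact: entrywise_trace_covector.
  by apply: entrywise_cmul; exact: entrywise_cst.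
by move=> t; rewrite [RHS]mxE.
Qed.

Lemma entrywise_krylov_mx (x : T -> 'cV[R]_m) :
  entrywise C x -> entrywise C (fun t => krylov_mx (G t) (x t)).
Proof.
move=> Cx i k; apply: (C_eq (f := fun t => krylov (G t) (x t) k i 0)); last first.
  by move=> t; rewrite mxE.
elim: (k : nat) i => [|l IH] i; first exact: Cx.
apply: (entrywise_cmul Cx _ i 0) => a b; rewrite [b]ord1; exact: IH.
Qed.

Lemma entrywise_poly_frame : entrywise C (fun t => poly_frame (G t)).
Proof.
apply: entrywise_krylov_mx; apply: entrywise_tr; apply: C_mulmx.
  exact: entrywise_trace_covector.
apply: entrywise_adj => //; exact: entrywise_trace_form.
Qed.

(** The inverse of the trace form is the only ingredient that ring operations do not supply, so it
    enters as a hypothesis; in the smooth case [smooth_invmx] provides it. *)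
Lemma entrywise_frame : entrywise C (fun t => invmx (trace_form (G t))) ->
  entrywise C (fun t => frame (G t)).
Proof.
move=> Cinv; apply: entrywise_krylov_mx; apply: entrywise_tr; apply: C_mulmx => //.
exact: entrywise_trace_covector.
Qed.

Lemma entrywise_ricci : entrywise C (fun t => ricci (G t)).
Proof.
move=> j k; apply: (C_eq (f := fun t => \sum_i \sum_n
    (chr (G t) i n i * chr (G t) j k n + (-1) * (chr (G t) j n i * chr (G t) i k n)))).
  apply: C_sum => i; apply: C_sum => n; apply: C_add.
    by apply: C_mul; exact: C_G.
  by apply: C_mul; first exact: C_cst; apply: C_mul; exact: C_G.
move=> t; rewrite mxE; apply: eq_bigr => i _; apply: eq_bigr => n _.
by rewrite mulN1r.
Qed.

Lemma entrywise_ricci_s : entrywise C (fun t => ricci_s (G t)).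
Proof.
move=> j k.
apply: (C_eq (f := fun t => 2^-1 * (ricci (G t) j k + ricci (G t) k j))).
  by apply: C_mul; [exact: C_cst|apply: C_add; exact: entrywise_ricci].
by move=> t; rewrite [RHS]mxE.
Qed.

Lemma closed_moduli_poly : C (fun t => moduli_poly (G t)).
Proof.
apply: C_mul; first by apply: closed_det => //; exact: entrywise_ricci_s.
apply: C_mul; first by apply: closed_det => //; exact: entrywise_trace_form.
by apply: closed_det => //; exact: entrywise_poly_frame.
Qed.

Lemma entrywise_chr_act (g : T -> 'M[R]_m) : entrywise C g ->
  entrywise C (fun t => invmx (g t)) -> entrywise C (fun t => chr_act (g t) (G t)).
Proof.
move=> Cg Cinv r k; case/mxvec_indexP: r => i j.
apply: (C_eq (f := fun t => (invmx (g t) *m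
    cmul (G t) (g t *m delta_mx i 0) (g t *m delta_mx j 0)) k 0)).
  apply: C_mulmx => //; apply: entrywise_cmul; apply: C_mulmx => //;
    exact: entrywise_cst.
by move=> t; rewrite -cmul_act -chrE.
Qed.

End ClosedChristoffel.

Section PolynomialFunctions.
Import -(notations) mpoly.
Context {R : realType} {m : nat}.

Definition is_chr_poly (f : 'M[R]_(m * m, m) -> R) : Prop :=
  exists P : chr_poly R m, forall G, chr_eval P G = f G.

Lemma is_chr_poly_cst a : is_chr_poly (fun=> a).
Proof. by exists (mpoly.mpolyC _ a) => G; exact: mpoly.mevalC. Qed.

Lemma is_chr_poly_add f g : is_chr_poly f -> is_chr_poly g ->
  is_chr_poly (fun G => f G + g G).
Proof.
move=> [P fP] [Q gQ]; exists ((P : mpoly.mpoly (m * m * m) R) + Q) => G.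
by rewrite -fP -gQ /chr_eval; exact: mpoly.mevalD.
Qed.

Lemma is_chr_poly_mul f g : is_chr_poly f -> is_chr_poly g ->
  is_chr_poly (fun G => f G * g G).
Proof.
move=> [P fP] [Q gQ]; exists ((P : mpoly.mpoly (m * m * m) R) * Q) => G.
by rewrite -fP -gQ /chr_eval; exact: mpoly.mevalM.
Qed.

Lemma is_chr_poly_coord : entrywise is_chr_poly id.
Proof.
move=> r k; exists (mpoly.mpolyX R (mpoly.mnm1 (mxvec_index r k))) => G.
rewrite /chr_eval -[RHS]mxvecE; exact: mpoly.mevalXU.
Qed.

End PolynomialFunctions.

(** * The slice of the action *)

(** Take [S] of maximal rank with row space inside [P]: a vector of [P] outside this row space could
    be adjoined and would raise the rank. *)
Lemma subspace_mx (F : fieldType) N (P : 'rV[F]_N -> Prop) :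
  P 0 -> (forall a x y, P x -> P y -> P (a *: x + y)) ->
  exists S : 'M[F]_N, forall x, P x <-> (x <= S)%MS.
Proof.
move=> P0 Plin.
pose Q r := `[< exists2 S : 'M[F]_N,
  \rank S = r & forall x, (x <= S)%MS -> P x >].
have Q0 : exists r, Q r.
  exists 0%N; apply/asboolP; exists 0; first exact: mxrank0.
  by move=> x; rewrite submx0 => /eqP ->.
have QN r : Q r -> (r <= N)%N by move=> /asboolP[S <- _]; exact: rank_leq_row.
have [r /asboolP[S rS SP] rmax] := ex_maxnP Q0 QN.
exists S => x; split; last exact: SP.
move=> Px; apply/negPn/negP => xS.
suff /rmax : Q (\rank (S + x)%MS).
  by rewrite -rS leqNgt => /negP; apply; apply: rank_ltmx; rewrite ltmxE addsmxSl
    addsmx_sub submx_refl.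
apply/asboolP; exists (S + x)%MS => // y /sub_addsmxP[[u w] /= ->].
rewrite addrC [w]mx11_scalar mul_scalar_mx; apply: Plin => //.
by apply: SP; exact: submxMl.
Qed.

Section Slice.
Context {R : realType} {n : nat}.
Local Notation m := n.+1.
Implicit Types G H : 'M[R]_(m * m, m).

Local Notation e i := (delta_mx i 0 : 'cV[R]_m).

(* On the nonvanishing locus of [moduli_poly] these linear equations describe
   the Christoffel arrays whose frame is the standard basis. *)
Definition slice_eqs G : Prop :=
  [/\ forall i k : 'I_m, (i < n)%N -> chr G 0 i k = (k == i.+1 :> nat)%:R,
      forall j, trace_covector G 0 j = trace_covector G 0 0 &
      \sum_k chr G 0 ord_max k = 1].

Lemma trace_covectorE G j : trace_covector G 0 j = \sum_k chr G j k k.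
Proof. by rewrite mxE /mxtrace; apply: eq_bigr => k _; rewrite Lmx_basis. Qed.

Lemma mul_covector_cmul G i : (trace_covector G *m cmul G (e 0) (e i)) 0 0 =
  \sum_k trace_covector G 0 k * chr G 0 i k.
Proof. by rewrite mxE; apply: eq_bigr => k _; rewrite -chrE. Qed.

(** Frame 1 means v = e_0 and e_0.e_i = e_(i+1). Evaluating w L_v = w at e_i makes consecutive
    entries of w equal; at the last basis vector it gives the sum condition times that common entry,
    nonzero since w = 0 would force v = 0. *)
Lemma frame_eq1_slice G : trace_form G \in unitmx -> frame G = 1%:M ->
  slice_eqs G.
Proof.
move=> Bu F1.
have kE (k : 'I_m) : krylov G (trace_vector G) k = e k.
  by rewrite -mul_krylov_mx -/(frame G) F1 mul1mx.
have vE : trace_vector G = e 0 := kE 0.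
have step (i k : 'I_m) : (i < n)%N -> chr G 0 i k = (k == i.+1 :> nat)%:R.
  move=> i_n; have i1 : (i.+1 < m)%N by [].
  have := kE (Ordinal i1); rewrite /krylov /= -/(krylov _ _ i) kE vE => cE.
  by rewrite chrE cE mxE eqxx andbT.
have wE i : (trace_covector G *m cmul G (e 0) (e i)) 0 0 = trace_covector G 0 i.
  have := (trace_vectorP (e 0) Bu).2 (esym vE) => /(congr1 (mulmx^~ (e i))).
  by rewrite -mulmxA Lmx_mul -colE => ->; rewrite mxE.
have const j : trace_covector G 0 j = trace_covector G 0 0.
  case: j => j jm; elim: j jm => [|j IH] jm.
    by congr (trace_covector G 0 _); exact: val_inj.
  have jm' : (j < m)%N := ltnW jm.
  rewrite -(IH jm') -[RHS]wE mul_covector_cmul (bigD1 (Ordinal jm)) //= step //=.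
  rewrite ?eqxx mulr1 big1 ?addr0 // => k kj.
  by rewrite step // -val_eqE /= in kj *; rewrite (negbTE kj) mulr0.
split => //.
have c0 : trace_covector G 0 0 != 0.
  apply/eqP => c0; have w0 : trace_covector G = 0.
    by apply/rowP => j; rewrite const c0 mxE.
  have := vE; rewrite /trace_vector w0 mul0mx trmx0 => /colP/(_ 0)/eqP.
  by rewrite !mxE !eqxx eq_sym oner_eq0.
have := wE ord_max; rewrite mul_covector_cmul const => wmax.
apply: (mulfI c0); rewrite mulr1 -[RHS]wmax mulr_sumr.
by apply: eq_bigr => k _; rewrite const.
Qed.

(** For w proportional to (1, ..., 1), the identity w L_(e_0) = w only asks that the components of
    each e_0.e_i sum to 1; hence e_0 is the trace vector and its iterates run through the basis. *)
Lemma slice_frame_eq1 G : trace_form G \in unitmx -> slice_eqs G ->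
  frame G = 1%:M.
Proof.
move=> Bu [step const sum1].
have cE (i : 'I_m) (i1 : (i.+1 < m)%N) : cmul G (e 0) (e i) = e (Ordinal i1).
  apply/colP => k; rewrite -chrE step //.
  by rewrite mxE eqxx andbT.
have vE : e 0 = trace_vector G.
  apply/trace_vectorP => //; apply: mx_eq_on_basis => i.
  rewrite -mulmxA Lmx_mul -colE.
  apply/colP => z; rewrite [z]ord1 mul_covector_cmul [RHS]mxE const.
  under eq_bigr do rewrite const.
  rewrite -mulr_sumr; suff -> : \sum_k chr G 0 i k = 1 by rewrite mulr1.
  have [i_n|] := ltnP i n; last first.
    move=> n_i; rewrite (_ : i = ord_max) //; apply: val_inj => /=.
    by apply/eqP; rewrite eqn_leq n_i -ltnS ltn_ord.
  have i1 : (i.+1 < m)%N by [].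
  rewrite (bigD1 (Ordinal i1)) //= step //= ?eqxx big1 ?addr0 // => k kj.
  by rewrite step // -val_eqE /= in kj *; rewrite (negbTE kj).
apply: mx_eq_on_basis => k; rewrite mul_krylov_mx mul1mx -vE.
case: k => k km; elim: k km => [|k IH] km.
  by congr (delta_mx _ 0); exact: val_inj.
rewrite /krylov /= -/(krylov _ _ k) (IH (ltnW km)) cE.
by congr (delta_mx _ 0); exact: val_inj.
Qed.

(** Since U K = 1, the product K U is a projection onto the directions of the slice, so being fixed
    by it encodes membership. *)
Lemma slice_param (L : set 'M[R]_(m * m, m)) G0 : linear_set L -> L G0 ->
  slice_eqs G0 ->
  exists d (U : 'M[R]_(d, m * m * m)) (K : 'M[R]_(m * m * m, d)),
    U *m K = 1%:M /\
    forall G, (L G /\ slice_eqs G) <->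
      mxvec (G - G0) *m K *m U = mxvec (G - G0).
Proof.
move=> [L0 Llin] LG0 S0.
(* The homogeneous form of the slice equations: the slice is the translate by [G0] of this linear
   subspace. *)
pose hom G := [/\ L G, forall i k : 'I_m, (i < n)%N -> chr G 0 i k = 0,
  forall j, trace_covector G 0 j = trace_covector G 0 0 &
  \sum_k chr G 0 ord_max k = 0].
have chrD a G H i j k : chr (a *: G + H) i j k = a * chr G i j k + chr H i j k.
  by rewrite /chr !mxE.
have tcD a G H j : trace_covector (a *: G + H) 0 j =
    a * trace_covector G 0 j + trace_covector H 0 j.
  rewrite !trace_covectorE mulr_sumr -big_split /=.
  by apply: eq_bigr => k _; rewrite chrD.
have hom0 : hom 0.
  split => //.
  - by move=> i k _; rewrite /chr mxE.
  - by move=> j; rewrite !trace_covectorE !big1 // => k _; rewrite /chr mxE.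
  - by rewrite big1 // => k _; rewrite /chr mxE.
have homD a G H : hom G -> hom H -> hom (a *: G + H).
  move=> [LG G1 G2 G3] [LH H1 H2 H3]; split.
  - exact: Llin.
  - by move=> i k i_n; rewrite chrD G1 // H1 // mulr0 addr0.
  - by move=> j; rewrite !tcD G2 H2.
  - under eq_bigr do rewrite chrD.
    by rewrite big_split /= -mulr_sumr G3 H3 mulr0 addr0.
have [|a x y|S SP] := @subspace_mx R _ (fun x => hom (vec_mx x)).
- by rewrite linear0.
- by rewrite linearP; exact: homD.
have homP G : hom G <-> (mxvec G <= S)%MS by rewrite -SP mxvecK.
(* The rows of [row_base S] form a basis of the directions, with coordinates given by a right
   inverse; the rank is the dimension of the slice. *)
exists (\rank S), (row_base S), (pinvmx (row_base S)); split.
  by rewrite mulmxVp // row_base_free.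
have [e1 e2 e3] := S0.
move=> G; have homG : L G /\ slice_eqs G <-> hom (G - G0).
  have GE : G - G0 = (-1) *: G0 + G by rewrite scaleN1r addrC.
  rewrite GE; split=> [[LG [f1 f2 f3]]|[LG f1 f2 f3]].
    split.
    - exact: Llin.
    - by move=> i k i_n; rewrite chrD f1 // e1 // mulN1r addNr.
    - by move=> j; rewrite !tcD f2 e2.
    - under eq_bigr do rewrite chrD.
      by rewrite big_split /= -mulr_sumr f3 e3 mulr1 addNr.
  split.
    have := Llin 1 _ _ LG0 LG.
    by rewrite scale1r scaleN1r addrA addrN add0r.
  split.
  - by move=> i k i_n; have := f1 i k i_n; rewrite chrD e1 // mulN1r addrC => /subr0_eq.
  - move=> j; have := f2 j; rewrite !tcD e2.
    by move/addrI.
  - move: f3; under eq_bigr do rewrite chrD.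
    by rewrite big_split /= -mulr_sumr e3 mulN1r addrC => /subr0_eq.
have baseE (x : 'rV[R]_(m * m * m)) : (x <= S)%MS = (x <= row_base S)%MS.
  by rewrite eq_row_base.
rewrite homG homP baseE; split=> [xS|<-]; last exact: submxMl.
by rewrite mulmxKpV.
Qed.

End Slice.

(** * Non-degenerate forms of a given signature *)

Section SignatureOpen.
Context {R : realType}.

Lemma continuous_mulmx_cst m n p q (A : 'M[R]_(m, n)) (B : 'M[R]_(p, q)) :
  continuous (fun S : 'M[R]_(n, p) => A *m S *m B).
Proof.
apply: continuous_mx_entries.
have Cc (a : R) : continuous (fun _ : 'M[R]_(n, p) => a) by exact: cst_continuous.
apply: (entrywise_mul Cc (@continuous_ringD _ _) (@continuous_ringM _ _)).
  apply: (entrywise_mul Cc (@continuous_ringD _ _) (@continuous_ringM _ _)).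
    exact: entrywise_cst.
  by move=> i j; exact: coord_continuous.
exact: entrywise_cst.
Qed.

Definition schur n (S : 'M[R]_(1 + n)) : 'M[R]_n :=
  drsubmx S - (S 0 0)^-1 *: ((ursubmx S)^T *m ursubmx S).

(** One step of symmetric Gaussian elimination: [P] splits [S] into its corner entry and its Schur
    complement, then [Q] rescales the first vector by [c] and applies [B] to the rest. *)
Lemma schur_congr n (S : 'M[R]_(1 + n)) (c : R) (B : 'M[R]_n) (d0 : R) (d : 'rV[R]_n) :
  S^T = S -> S 0 0 != 0 -> c != 0 -> c ^+ 2 * S 0 0 = d0 -> B \in unitmx ->
  B^T *m schur S *m B = diag_mx d ->
  exists2 A : 'M[R]_(1 + n), A \in unitmx &
    A^T *m S *m A = diag_mx (row_mx (\row_(i < 1) d0) d).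
Proof.
move=> symS a0 c0 cE Bu BS; set a := S 0 0 in a0 cE BS *.
set b := ursubmx S.
pose P : 'M[R]_(1 + n) := block_mx 1%:M (- a^-1 *: b) 0 1%:M.
pose Q : 'M[R]_(1 + n) := block_mx c%:M 0 0 B.
exists (P *m Q).
  rewrite unitmx_mul !unitmxE !det_ublock !det1 mulr1 unitr1 /=.
  by rewrite det_scalar1 unitrM unitfE c0 -unitmxE.
have SE : S = block_mx a%:M b b^T (drsubmx S).
  rewrite -[LHS]submxK; congr block_mx; last by rewrite /b trmx_ursub symS.
  apply/matrixP => i j; rewrite !ord1 !mxE eqxx mulr1n /a.
  by congr (S _ _); exact: val_inj.
have PSP : P^T *m S *m P = block_mx a%:M 0 0 (schur S).
  rewrite {1}SE tr_block_mx !trmx1 trmx0 linearZ /= !mulmx_block.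
  rewrite !mul1mx !mul0mx !mulmx1 !mulmx0 !addr0.
  have bE : - a^-1 *: b^T *m a%:M + b^T = 0.
    by rewrite mul_mx_scalar scalerA mulrN mulfV // scaleN1r addNr.
  rewrite bE mul0mx add0r; congr block_mx.
    by rewrite mul_scalar_mx scalerA mulrN mulfV // scaleN1r addNr.
  by rewrite -scalemxAl scaleNr addrC.
have QE : Q^T *m block_mx a%:M 0 0 (schur S) *m Q =
    block_mx d0%:M 0 0 (diag_mx d).
  rewrite tr_block_mx !trmx0 tr_scalar_mx !mulmx_block.
  rewrite !(mul0mx, mulmx0, addr0, add0r) BS.
  by rewrite -!scalar_mxM -cE expr2 mulrAC.
rewrite trmx_mul !mulmxA -(mulmxA Q^T) -(mulmxA Q^T) PSP QE diag_mx_row.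
congr block_mx; apply/matrixP => i j.
by rewrite !ord1 !mxE eqxx.
Qed.

Lemma schur_continuous n (J : 'M[R]_(1 + n)) :
  J 0 0 != 0 -> {for J, continuous (@schur n)}.
Proof.
move=> J0; apply: (@cvg_mx R _ (nbhs J)) => i j.
have schurE S : schur S i j = S (rshift 1 i) (rshift 1 j) -
    (S 0 0)^-1 * (S (lshift n 0) (rshift 1 i) * S (lshift n 0) (rshift 1 j)).
  by rewrite !mxE big_ord1 !mxE.
rewrite (_ : (fun S => schur S i j) = (fun S : 'M[R]_(1 + n) =>
    S (rshift 1 i) (rshift 1 j) - (S 0 0)^-1 *
    (S (lshift n 0) (rshift 1 i) * S (lshift n 0) (rshift 1 j)))); last first.
  by apply/funext => S; exact: schurE.
rewrite schurE; apply: cvgB; first exact: coord_continuous.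
apply: cvgM; first by apply: cvgV => //; exact: coord_continuous.
by apply: cvgM; exact: coord_continuous.
Qed.

(** Induction on the size: near [diag_mx d] the corner entry keeps its sign, and the Schur
    complement, continuous there, stays near the smaller diagonal matrix. *)
Lemma near_sign_diag_congr n (d : 'rV[R]_n) :
  (forall i, d 0 i = 1 \/ d 0 i = -1) ->
  \forall S \near (diag_mx d : 'M[R]_n), S^T = S ->
    exists2 B : 'M[R]_n, B \in unitmx & B^T *m S *m B = diag_mx d.
Proof.
elim: n d => [|n IH] d dP.
  near=> S => _; exists 1%:M; first exact: unitmx1.
  by apply/matrixP => -[].
pose d' : 'rV[R]_n := rsubmx (d : 'rV[R]_(1 + n)).
have d'P i : d' 0 i = 1 \/ d' 0 i = -1 by rewrite mxE; exact: dP.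
have d2 : d 0 0 * d 0 0 = 1.
  by case: (dP 0) => ->; rewrite ?mulrNN mulr1.
have d00 : d 0 0 != 0.
  by apply/eqP => d0; move: d2; rewrite d0 mul0r => /esym/eqP; rewrite oner_eq0.
pose J : 'M[R]_(1 + n) := diag_mx d.
have J00 : J 0 0 = d 0 0 by rewrite mxE eqxx mulr1n.
have schurJ : schur J = diag_mx d'.
  rewrite /schur (_ : ursubmx J = 0) ?mulmx0 ?scaler0 ?subr0; last first.
    by apply/matrixP => i j; rewrite [i]ord1 !mxE; case: eqVneq => // /(congr1 val).
  by apply/matrixP => i j; rewrite !mxE.
have near_schur : \forall S \near J, (schur S)^T = schur S ->
    exists2 B : 'M[R]_n, B \in unitmx & B^T *m schur S *m B = diag_mx d'.
  have Jc : {for J, continuous (@schur n)}.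
    by apply: schur_continuous; rewrite J00.
  have := IH d' d'P; rewrite -{1}schurJ => nJ.
  exact: (Jc _ nJ).
have near_sign : \forall S \near J, 0 < d 0 0 * (S : 'M[R]_(1 + n)) 0 0.
  have cJ : d 0 0 * (S : 'M[R]_(1 + n)) 0 0 @[S --> J] --> d 0 0 * J 0 0.
    apply: (@cvgM _ _ (nbhs J) _ (fun=> d 0 0) (fun S : 'M[R]_(1 + n) => S 0 0)).
      exact: cvg_cst.
    exact: coord_continuous.
  by apply: (cvgr_gt (d 0 0 * J 0 0) cJ); rewrite J00 d2 ltr01.
near=> S => symS.
have a0 : 0 < d 0 0 * S 0 0 by near: S.
have symSchur : (schur (S : 'M[R]_(1 + n)))^T = schur (S : 'M[R]_(1 + n)).
  rewrite /schur linearB /= linearZ /= trmx_mul trmxK.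
  by rewrite trmx_drsub symS.
have nS : (schur (S : 'M[R]_(1 + n)))^T = schur (S : 'M[R]_(1 + n)) ->
    exists2 B : 'M[R]_n, B \in unitmx &
      B^T *m schur (S : 'M[R]_(1 + n)) *m B = diag_mx d'.
  by near: S; exact: near_schur.
have [B Bu BS] := nS symSchur.
(* With this scale c^2 S_00 = 1/d_0, which is d_0 because d_0 is 1 or -1. *)
pose c := Num.sqrt (d 0 0 * S 0 0)^-1.
have c2 : c ^+ 2 = (d 0 0 * S 0 0)^-1 by rewrite sqr_sqrtr // invr_ge0 ltW.
have S00 : (S : 'M[R]_(1 + n)) 0 0 != 0.
  by apply/eqP => S00; move: a0; rewrite S00 mulr0 ltxx.
have c0 : c != 0.
  by apply: contraTneq isT => c0; move: c2; rewrite c0 expr0n => /esym/eqP;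
    rewrite invr_eq0 gt_eqF.
have cE : c ^+ 2 * (S : 'M[R]_(1 + n)) 0 0 = d 0 0.
  by rewrite c2 invfM mulfVK // -[LHS]mul1r -d2 -mulrA mulfV // mulr1.
have [A Au AE] := @schur_congr n S c B (d 0 0) d' symS S00 c0 cE Bu BS.
exists A => //; rewrite AE; congr diag_mx.
have -> : \row_(i < 1) d 0 0 = lsubmx (d : 'rV[R]_(1 + n)).
  by apply/rowP => i; rewrite !mxE; congr (d _ _); apply: val_inj; rewrite /= ord1.
by rewrite hsubmxK.
Unshelve. all: by end_near. Qed.

(** In a basis [B] orthonormal at [G], the forms of nearby arrays are symmetric and close to a
    diagonal of signs, hence congruent to it by some [A]; then [B *m A] is an orthonormal basis for
    them. *)
Lemma open_signature m p q :
  open [set G : 'M[R]_(m * m, m) | has_signature p q (ricci_s G)].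
Proof.
have cr : continuous (fun G : 'M[R]_(m * m, m) => ricci_s G).
  apply: continuous_mx_entries; apply: entrywise_ricci_s.
  - by move=> a; exact: cst_continuous.
  - exact: continuous_ringD.
  - exact: continuous_ringM.
  - by move=> i j; exact: coord_continuous.
rewrite openE => G [pq [B Bu BE]].
have cc : continuous (fun H : 'M[R]_(m * m, m) => B^T *m ricci_s H *m B).
  move=> H; apply: (@continuous_comp _ _ _ (fun G : 'M[R]_(m * m, m) => ricci_s G)
    (fun S => B^T *m S *m B)); first exact: cr.
  exact: continuous_mulmx_cst.
set d := \row_i _ in BE.
have /near_sign_diag_congr nd : forall i, d 0 i = 1 \/ d 0 i = -1.
  by move=> i; rewrite mxE; case: ifP; [right|left].
rewrite -BE in nd.
have : \forall H \near G, (B^T *m ricci_s H *m B)^T = B^T *m ricci_s H *m B ->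
    exists2 A : 'M[R]_m, A \in unitmx &
      A^T *m (B^T *m ricci_s H *m B) *m A = B^T *m ricci_s G *m B.
  exact: (cc G _ nd).
apply: filterS => H HA; have [|A Au AE] := HA.
  by rewrite !trmx_mul trmxK ricci_s_tr mulmxA.
split => //; exists (B *m A); first by rewrite unitmx_mul Bu.
by rewrite trmx_mul !mulmxA -BE -AE !mulmxA.
Qed.

End SignatureOpen.

(** * A torsion free array off the zero set *)

Section Example.
Context {R : realType} {n : nat}.
Hypothesis n2 : (2 <= n)%N.
Local Notation m := n.+1.

Local Notation e i := (delta_mx i 0 : 'cV[R]_m).

Let ordS_neq (i : 'I_m) : ordS i != i.
Proof.
rewrite -val_eqE; have [i_n|n_i] := ltnP i n.
  by rewrite /= modn_small // gtn_eqF.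
have -> : i = ord_max by apply: val_inj; apply/eqP; rewrite eqn_leq n_i -ltnS ltn_ord.
by rewrite /= modnn; case: n n2.
Qed.

(** This is where m >= 3 enters: for m = 2 the off-diagonal entries M i j and M j i of the matrix
    below would both be nonzero, and the Ricci tensor would not be diagonal. *)
Let ordS2_neq (i : 'I_m) : ordS (ordS i) != i.
Proof.
rewrite -val_eqE /= -addn1 modnDml addn1.
have [i_n|n_i] := ltnP i.+2 m; first by rewrite modn_small // gtn_eqF.
have im := ltn_ord i.
rewrite -(subnK n_i) modnDr modn_small; last by lia.
by apply/eqP; lia.
Qed.

Definition cycle_mx (a b : 'I_m -> R) : 'M[R]_m :=
  \matrix_(k, j) ((k == j)%:R * a j + (k == ordS j)%:R * b j).

Lemma sum_cycle_mx a b j : \sum_k cycle_mx a b k j = a j + b j.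
Proof.
under eq_bigr do rewrite mxE; rewrite big_split /=; congr (_ + _).
  by rewrite (bigD1 j) //= eqxx mul1r big1 ?addr0 // => k /negbTE ->; rewrite mul0r.
rewrite (bigD1 (ordS j)) //= eqxx mul1r big1 ?addr0 // => k /negbTE ->.
by rewrite mul0r.
Qed.

Lemma cycle_mx_diag a b j : cycle_mx a b j j = a j.
Proof. by rewrite mxE eqxx eq_sym (negbTE (ordS_neq j)) mul1r mul0r addr0. Qed.

Lemma cycle_mx_opp a b i j : i != j -> cycle_mx a b i j * cycle_mx a b j i = 0.
Proof.
move=> ij; rewrite !mxE [j == i]eq_sym (negbTE ij) !mul0r !add0r.
have [->|_] := eqVneq j (ordS i); last by rewrite mul0r mulr0.
by rewrite eq_sym (negbTE (ordS2_neq i)) !mul0r.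
Qed.

Variable x : 'I_m -> R.
Hypothesis x0 : forall i, x i != 0.
Hypothesis x1 : forall i, x i != 1.

(** Chosen so that column j of [M] sums to 1 / x_j. As the trace covector is (1, ..., 1), the trace
    form is then diag(1 / x_j) and the trace vector is x, which is thus prescribed at will; x_j
    different from 1 keeps the Ricci tensor non-degenerate. *)
Let t i := (1 - x i) / x i.
Let M := cycle_mx (fun=> 1) t.

(* The commutative algebra with e_i e_j = 0 for i <> j and
   e_i e_i = e_i + t_i e_(i + 1), indices modulo m. *)
Let G : 'M[R]_(m * m, m) := mk_chr (fun i j k => (i == j)%:R * M k j).

Let chrG i j k : chr G i j k = (i == j)%:R * M k j.
Proof. by rewrite chr_mk. Qed.

Let t1 i : 1 + t i = (x i)^-1.
Proof. by rewrite /t mulrBl divff // mul1r addrC subrK. Qed.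

Let sumM j : \sum_k M k j = (x j)^-1.
Proof. by rewrite sum_cycle_mx t1. Qed.

Lemma example_torsion_free : torsion_free G.
Proof. by move=> i j k; rewrite !chrG; case: (eqVneq i j) => [->|]; rewrite ?mul0r. Qed.

Let covector1 j : trace_covector G 0 j = 1.
Proof.
rewrite mxE /mxtrace (bigD1 j) //= Lmx_basis chrG eqxx mul1r cycle_mx_diag.
rewrite big1 ?addr0 // => k kj.
by rewrite Lmx_basis chrG eq_sym (negbTE kj) mul0r.
Qed.

Lemma example_trace_form : trace_form G = diag_mx (\row_j (x j)^-1).
Proof.
apply/matrixP => i j; rewrite !mxE.
under eq_bigr do rewrite covector1 mul1r -chrE chrG.
by rewrite -mulr_sumr sumM; case: eqVneq => [->|]; rewrite ?mul1r ?mul0r.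
Qed.

Lemma example_ricci : ricci G = diag_mx (\row_j t j).
Proof.
apply/matrixP => i j; rewrite !mxE.
have -> : \sum_a \sum_b (chr G a b a * chr G i j b - chr G i b a * chr G a j b) =
    (i == j)%:R * (x j)^-1 - M j i * M i j.
  under eq_bigr do rewrite sumrB; rewrite sumrB; congr (_ - _).
    rewrite -sumM mulr_sumr; apply: eq_bigr => a _.
    rewrite (bigD1 a) //= big1 ?addr0.
      by rewrite !chrG eqxx cycle_mx_diag !mul1r.
    by move=> b ba; rewrite !chrG eq_sym (negbTE ba) !mul0r.
  rewrite (bigD1 j) //= [X in _ + X]big1 ?addr0.
    rewrite (bigD1 i) //= [X in _ + X]big1 ?addr0.
      by rewrite !chrG !eqxx !mul1r.
    by move=> b bi; rewrite !chrG eq_sym (negbTE bi) !mul0r.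
  move=> a aj; rewrite big1 // => b _.
  by rewrite [X in _ * X]chrG (negbTE aj) mul0r mulr0.
case: eqVneq => [->|ij].
  by rewrite !cycle_mx_diag !mul1r -t1 addrAC subrr add0r.
by rewrite cycle_mx_opp 1?eq_sym // mul0r subr0.
Qed.

Let X : 'cV[R]_m := \col_j x j.

Let LX : Lmx G X = cycle_mx x (fun j => 1 - x j).
Proof.
apply/matrixP => k j; rewrite [LHS]mxE (bigD1 j) //= big1 ?addr0.
  rewrite chrG eqxx mul1r !mxE mulrDr mulrCA mulr1; congr (_ + _).
  by rewrite mulrCA; congr (_ * _); rewrite /t mulrC mulfVK.
by move=> i ij; rewrite chrG (negbTE ij) mul0r mulr0.
Qed.

(** Left multiplication by x turns t_j into t_j x_j = 1 - x_j, so the division disappears and the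
    matrix makes sense even where entries of [y] vanish, although the algebra does not. *)
Definition cycle_krylov (y : 'I_m -> R) : 'M[R]_m :=
  \matrix_(i, k) iter k (mulmx (cycle_mx y (fun j => 1 - y j))) (\col_j y j) i 0.

Let ricci_det_neq0 : \det (ricci_s G) != 0.
Proof.
have -> : ricci_s G = ricci G.
  have half : 2^-1 + 2^-1 = 1 :> R by rewrite [RHS]splitr div1r.
  by rewrite ricci_sE example_ricci tr_diag_mx scalerDr -scalerDl half scale1r.
rewrite example_ricci det_diag; apply/prodf_neq0 => i _.
by rewrite mxE mulf_neq0 ?invr_eq0 // subr_eq0 eq_sym.
Qed.

Let trace_form_unit : trace_form G \in unitmx.
Proof.
rewrite unitmxE unitfE example_trace_form det_diag.
by apply/prodf_neq0 => i _; rewrite mxE invr_eq0.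
Qed.

Let trace_vectorX : X = trace_vector G.
Proof.
apply/(trace_vectorP _ trace_form_unit); apply/rowP => j.
rewrite covector1 LX mxE.
under eq_bigr do rewrite covector1 mul1r.
by rewrite sum_cycle_mx addrC subrK.
Qed.

Let frame_cycle_krylov : frame G = cycle_krylov x.
Proof.
rewrite /frame -trace_vectorX; apply/matrixP => i k.
rewrite [LHS]mxE [RHS]mxE; congr ((_ : 'cV[R]_m) i 0).
elim: (k : nat) => [|l IH]; first by [].
by rewrite /krylov !iterS -/(krylov _ _ l) IH -Lmx_mul LX.
Qed.

Lemma example_moduli_poly : \det (cycle_krylov x) != 0 -> moduli_poly G != 0.
Proof.
move=> K0; apply/moduli_poly_neq0; split.
- exact: ricci_det_neq0.
- exact: trace_form_unit.
- by rewrite unitmxE unitfE frame_cycle_krylov.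
Qed.

End Example.

Section ExampleExists.
Context {R : realType} {n : nat}.
Hypothesis n2 : (2 <= n)%N.
Local Notation m := n.+1.

Let y (s : R) (j : 'I_m) : R := if j == 0 then 2^-1 else s.

Let half_lt1 : (2^-1 : R) < 1.
Proof. by rewrite invf_lt1 // ltr1n. Qed.

(* At s = 0 the Krylov matrix is triangular with nonzero diagonal. *)
Lemma det_cycle_krylov0 : \det (cycle_krylov (y 0)) != 0.
Proof.
pose N := cycle_mx (y 0) (fun j => 1 - y 0 j).
pose u k : 'cV[R]_m := iter k (mulmx N) (\col_j y 0 j).
(* At s = 0 the matrix [N] sends e_0 to (e_0 + e_1)/2 and every other e_j to the next basis vector,
   so [u k] ends exactly at index k; for k < m the cycle has not yet closed up. *)
have uP (k : nat) (km : (k < m)%N) :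
    (forall i : 'I_m, (k < i)%N -> u k i 0 = 0) /\ u k (Ordinal km) 0 != 0.
  elim: k km => [|k IH] km.
    split=> [i i0|]; rewrite mxE /y.
      by rewrite -val_eqE /= gtn_eqF.
    by rewrite -val_eqE /= invr_eq0 pnatr_eq0.
  have [uk0 ukk] := IH (ltnW km).
  have Sk : ordS (Ordinal (ltnW km)) = Ordinal km.
    by apply: val_inj; rewrite /= modn_small.
  split=> [i ki|].
    rewrite /u iterS -/(u k) mxE big1 // => j _.
    have [kj|jk] := ltnP k j; first by rewrite uk0 // mulr0.
    rewrite mxE -!val_eqE /= modn_small; last by lia.
    by rewrite !gtn_eqF ?mul0r ?addr0 ?mul0r //; lia.
  rewrite /u iterS -/(u k) mxE (bigD1 (Ordinal (ltnW km))) //= big1 ?addr0.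
    rewrite mulf_neq0 // mxE Sk eqxx -val_eqE /= gtn_eqF // mul0r add0r mul1r /y.
    case: ifP => _; last by rewrite subr0 oner_eq0.
    by rewrite subr_eq0 eq_sym lt_eqF ?half_lt1.
  move=> j jk; have [kj|{}jk'] := ltnP k j; first by rewrite uk0 // mulr0.
  have {}jk' : (j < k)%N by rewrite ltn_neqAle jk' andbT.
  rewrite mxE -!val_eqE /= modn_small; last by lia.
  by rewrite !gtn_eqF ?mul0r ?addr0 ?mul0r //; lia.
rewrite -det_tr det_trig.
  apply/prodf_neq0 => i _; rewrite !mxE -/N -/(u i).
  by have [_] := uP i (ltn_ord i); congr (u i _ 0 != 0); exact: val_inj.
apply/is_trig_mxP => i j ij; rewrite !mxE -/N -/(u i).
by have [ui _] := uP i (ltn_ord i); exact: ui.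
Qed.

Lemma moduli_poly_nonzero :
  exists2 G : 'M[R]_(m * m, m), torsion_free G & moduli_poly G != 0.
Proof.
have cy j : continuous (fun s => y s j).
  by rewrite /y; case: (j == 0); [exact: cst_continuous|move=> s; exact: cvg_id].
have Cc (a : R) : continuous (fun _ : R => a) by exact: cst_continuous.
have Cd := @continuous_ringD R R; have Cm := @continuous_ringM R R.
have cN : entrywise (fun f : R -> R => continuous f)
    (fun s => cycle_mx (y s) (fun j => 1 - y s j)).
  move=> i j.
  rewrite [X in continuous X](_ : _ = (fun s => (i == j)%:R * y s j +
      (i == ordS j)%:R * (1 + (-1) * y s j))).
    by apply: (Cd); apply: (Cm) => //; apply: (Cd) => //; apply: (Cm).
  by apply/funext => s; rewrite mxE mulN1r.
have cK : continuous (fun s => \det (cycle_krylov (y s))).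
  apply: (@closed_det _ _ (fun f : R -> R => continuous f)) => // i k.
  rewrite [X in continuous X](_ : _ = (fun s => iter k (mulmx (cycle_mx (y s)
      (fun j => 1 - y s j))) (\col_j y s j) i 0)); last first.
    by apply/funext => s; rewrite mxE.
  elim: (k : nat) i => [|l IH] i /=.
    rewrite [X in continuous X](_ : _ = (fun s => y s i)) //.
    by apply/funext => s; rewrite mxE.
  apply: (entrywise_mul Cc Cd Cm cN) => a b; rewrite [b]ord1; exact: IH.
(* The value s = 0 is excluded from the example, which divides by the entries; by continuity the
   determinant stays nonzero for small s, and s < 1 keeps the entries away from 1. *)
have [s [[s0 s1] Ks]] : exists s : R, (s != 0 /\ s < 1) /\ \det (cycle_krylov (y s)) != 0.
  apply: (@filter_ex _ (0 : R)^').
  near=> s; split; [split|]; near: s.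
  - exact: nbhs_dnbhs_neq.
  - by apply: nbhs_dnbhs; apply: lt_nbhsl; exact: ltr01.
  - apply: nbhs_dnbhs.
    by apply: (cvgr_neq0 _ (cK 0)); exact: det_cycle_krylov0.
exists (mk_chr (fun i j k => (i == j)%:R *
    cycle_mx (fun=> 1) (fun l => (1 - y s l) / y s l) k j)).
  exact: example_torsion_free.
apply: example_moduli_poly => //.
  by move=> i; rewrite /y; case: ifP; rewrite // invr_eq0 pnatr_eq0.
by move=> i; rewrite /y; case: ifP => _; rewrite lt_eqF ?half_lt1.
Unshelve. all: by end_near. Qed.

End ExampleExists.

(** * The strata *)

Section Stratum.
Context {R : realType} {n : nat}.
Local Notation m := n.+1.
Variables (L : set 'M[R]_(m * m, m)) (p q : nat) (P : chr_poly R m).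
(** [G0] is not assumed to have signature (p, q): normalized by its own frame it gives the base
    point [G1] of the slice, so a single array serves every stratum, even an empty one. *)
Variable G0 : 'M[R]_(m * m, m).
Hypothesis linL : linear_set L.
Hypothesis L_act : forall T G, L G -> L (chr_act T G).
Hypothesis LG0 : L G0.
Hypothesis G0_neq0 : moduli_poly G0 != 0.
Hypothesis P_eval : forall G, chr_eval P G = moduli_poly G.

Local Notation E := 'M[R]_(m * m, m).
Local Notation N := (chr_stratum L p q P).

Let O : set E := [set G | has_signature p q (ricci_s G)] `&`
  [set G | moduli_poly G != 0].

Let NE : N = O `&` L.
Proof.
apply/seteqP; split=> G /=; rewrite /chr_stratum /= P_eval.
  by move=> [LG sG PG].
by move=> [[sG PG] LG].
Qed.

Let oO : open O.
Proof.
apply: openI; first exact: open_signature.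
have cP : continuous (@moduli_poly R m).
  apply: (@closed_moduli_poly R m _ (fun f : E -> R => continuous f)).
  - by move=> a; exact: cst_continuous.
  - exact: continuous_ringD.
  - exact: continuous_ringM.
  - by move=> i j; exact: coord_continuous.
by apply: (open_comp _ (@open_neq R 0)) => G _; exact: cP.
Qed.

Let N_moduli G : N G -> moduli_poly G != 0.
Proof. by move=> []; rewrite P_eval. Qed.

Let N_form G : N G -> trace_form G \in unitmx.
Proof. by move=> /N_moduli/moduli_poly_neq0[]. Qed.

Let N_frame G : N G -> frame G \in unitmx.
Proof. by move=> /N_moduli/moduli_poly_neq0[]. Qed.

Let N_act g G : g \in unitmx -> N G -> N (chr_act g G).
Proof.
move=> gu; rewrite /chr_stratum /= !P_eval => -[LG sG PG]; split.
- exact: L_act.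
- by rewrite ricci_s_act //; exact: has_signature_congr.
- exact: moduli_poly_act.
Qed.

Let N_frame_act g G : g \in unitmx -> N G ->
  frame (chr_act g G) = invmx g *m frame G.
Proof. by move=> gu NG; apply: frame_act => //; exact: N_form. Qed.

Let LN : rel_open L N.
Proof. by rewrite NE; exact: rel_openI. Qed.

Let frame_smooth_N : entrywise (smooth_real L N) (@frame R m).
Proof.
have Cid : entrywise (smooth_real L N) (id : E -> E).
  by move=> i j; exact: smooth_coord.
apply: (entrywise_frame (smooth_real_cst LN) (smooth_add LN) (smooth_mul LN) Cid).
apply: smooth_invmx => //.
exact: (entrywise_trace_form (smooth_real_cst LN) (smooth_add LN) (smooth_mul LN) Cid).
Qed.

Let act_smooth_N :
  smooth_on (L `*` setT) (N `*` @GLplus R m) (fun xg => chr_act xg.2 xg.1).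
Proof.
have W := rel_openX LN (@open_GLplus R m).
have Cg : entrywise (smooth_real (L `*` setT) (N `*` @GLplus R m))
    (fun xg : E * 'M[R]_m => xg.2).
  by move=> i j; exact: smooth_coord2.
apply: smooth_mx => //.
apply: (entrywise_chr_act (smooth_real_cst W) (smooth_add W) (smooth_mul W)) => //.
  by move=> i j; exact: smooth_coord1.
by apply: smooth_invmx => // -[G g] [_ /= g0]; rewrite unitmxE unitfE gt_eqF.
Qed.

Let normal_smooth_N : entrywise (smooth_real L N) (fun G => chr_act (frame G) G).
Proof.
apply: (entrywise_chr_act (smooth_real_cst LN) (smooth_add LN) (smooth_mul LN)) => //.
  by move=> i j; exact: smooth_coord.
by apply: smooth_invmx => // G; exact: N_frame.
Qed.

Let chr_act_continuous g : continuous (@chr_act R m g).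
Proof.
have Cc (a : R) : continuous (fun _ : E => a) by exact: cst_continuous.
apply: continuous_mx_entries.
apply: (@entrywise_chr_act R m _ (fun f : E -> R => continuous f) Cc
  (@continuous_ringD _ _) (@continuous_ringM _ _) id _ (fun=> g)).
- by move=> i j; exact: coord_continuous.
- exact: entrywise_cst.
- exact: entrywise_cst.
Qed.

Let G1 := chr_act (frame G0) G0.

Let slice_G1 : slice_eqs G1.
Proof.
have [_ Bu Fu] := (moduli_poly_neq0 G0).1 G0_neq0.
apply: frame_eq1_slice; first exact: trace_form_act_unit.
by rewrite frame_act // mulVmx.
Qed.

Let reflection (e : bool) : 'M[R]_m :=
  if e then 1%:M else diag_mx (\row_i (if i == 0 then -1 else 1)).

Let det_reflection e : \det (reflection e) = if e then 1 else -1.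
Proof.
case: e; first exact: det1.
rewrite det_diag big_ord_recl mxE eqxx big1 ?mulr1 // => i _.
by rewrite mxE.
Qed.

Lemma chr_stratum_bundle :
  [/\ invariant_set chr_act N, proper_action chr_act N,
      without_fixed_points chr_act N &
      exists (d : nat) (A : set (chart (orbit_space chr_act N) d)),
        smooth_principal_bundle chr_act L (@orbit_proj _ _ _ chr_act N) A].
Proof.
split.
- exact: (equivariant_frame_invariant N_act).
- exact: (equivariant_frame_proper linL oO NE N_act N_frame N_frame_act frame_smooth_N).
- exact: (equivariant_frame_free (@chr_act1 R m) N_frame N_frame_act).
have [d [U [K [UK sliceP]]]] := slice_param linL (L_act _ LG0) slice_G1.
pose iota (y : 'rV[R]_d) : E := G1 + vec_mx (y *m U).
pose kappa (G : E) : 'rV[R]_d := mxvec (G - G1) *m K.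
have iotaB y : mxvec (iota y - G1) = y *m U by rewrite /iota addrC addKr vec_mxK.
have iotaK : cancel iota kappa.
  by move=> y; rewrite /kappa iotaB -mulmxA UK mulmx1.
have slice_iota y : L (iota y) /\ slice_eqs (iota y).
  by apply/sliceP; rewrite iotaB -(mulmxA y) UK mulmx1.
(* As [iota] is affine it preserves every class [C]; this gives at once its continuity and the
   smoothness of maps built from it. *)
have iota_entries (T : Type) (C : (T -> R) -> Prop) (y : T -> 'rV[R]_d) :
    (forall a, C (fun=> a)) ->
    (forall f g, C f -> C g -> C (fun x => f x + g x)) ->
    (forall f g, C f -> C g -> C (fun x => f x * g x)) ->
    entrywise C y -> entrywise C (fun t => iota (y t)).
  move=> Cc Ca Cm Cy r k.
  rewrite [X in C X](_ : _ = (fun t => G1 r k + (y t *m U) 0 (mxvec_index r k))).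
    have CyU : entrywise C (fun t => y t *m U).
      by apply: (entrywise_mul Cc Ca Cm Cy); exact: entrywise_cst.
    by apply: Ca; [exact: Cc|exact: CyU].
  by apply/funext => t; rewrite /iota [LHS]mxE [X in _ + X]mxE.
have kappa_entries (T : Type) (C : (T -> R) -> Prop) (G : T -> E) :
    (forall a, C (fun=> a)) ->
    (forall f g, C f -> C g -> C (fun x => f x + g x)) ->
    (forall f g, C f -> C g -> C (fun x => f x * g x)) ->
    entrywise C G -> entrywise C (fun t => kappa (G t)).
  move=> Cc Ca Cm CG; apply: (entrywise_mul Cc Ca Cm); last exact: entrywise_cst.
  move=> i r; rewrite [i]ord1; case/mxvec_indexP: r => a b.
  rewrite [X in C X](_ : _ = (fun t => G t a b + - G1 a b)).
    by apply: Ca; [exact: CG|exact: Cc].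
  by apply/funext => t; rewrite mxvecE !mxE.
have iota_continuous : continuous iota.
  apply: continuous_mx_entries; apply: iota_entries.
  - by move=> a; exact: cst_continuous.
  - exact: continuous_ringD.
  - exact: continuous_ringM.
  - by move=> i j; exact: coord_continuous.
have L_iota y : L (iota y) by have [] := slice_iota y.
exists d, (slice_atlas frame iota kappa reflection).
apply: (@equivariant_frame_bundle R m d E chr_act L N O frame iota kappa reflection).
- exact: chr_act1.
- exact: chr_actM.
- exact: linL.
- exact: oO.
- exact: NE.
- exact: N_act.
- exact: N_frame.
- exact: N_frame_act.
- exact: iotaK.
- exact: L_iota.
- move=> y /N_form Bu; apply: slice_frame_eq1 => //.
  by have [] := slice_iota y.
- move=> G NG F1; have /sliceP GE : L G /\ slice_eqs G.
    split; first by case: NG.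
    by apply: frame_eq1_slice => //; exact: N_form.
  by rewrite /iota /kappa GE mxvecK addrC subrK.
- exact: det_reflection.
- exact: chr_act_continuous.
- exact: iota_continuous.
- exact: act_smooth_N.
- exact: frame_smooth_N.
- apply: smooth_mx => //.
  exact: (kappa_entries _ _ _ (smooth_real_cst LN) (smooth_add LN)
    (smooth_mul LN) normal_smooth_N).
- move=> e; set V := [set y | N (iota y)].
  have V_open : rel_open setT (V `*` @GLplus R m).
    rewrite -setXTT; apply: rel_openX; last exact: open_GLplus.
    by apply: rel_open_open; exact: (open_slice_domain oO NE L_iota iota_continuous).
  have Cg : entrywise (smooth_real setT (V `*` @GLplus R m))
      (fun yg : 'rV[R]_d * 'M[R]_m => reflection e *m yg.2).
    apply: (entrywise_mul (smooth_real_cst V_open) (smooth_add V_open)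
      (smooth_mul V_open)).
      by apply: entrywise_cst; exact: smooth_real_cst.
    by move=> i j; exact: smooth_coord2.
  apply: smooth_mx => //.
  apply: (entrywise_chr_act (smooth_real_cst V_open) (smooth_add V_open)
    (smooth_mul V_open)) => //.
    apply: iota_entries; [exact: smooth_real_cst|exact: smooth_add|exact: smooth_mul|].
    by move=> i j; exact: smooth_coord1.
  apply: smooth_invmx => // -[y g] [_ /= g0].
  rewrite unitmxE unitfE det_mulmx det_reflection mulf_neq0 ?(gt_eqF g0) //.
  by case: e {Cg}; rewrite ?oppr_eq0 oner_eq0.
Qed.

End Stratum.

Theorem theorem1p6 (R : realType) (m : nat) (hm : (3 <= m)%N) :
  exists P : chr_poly R m,
    (exists Q : chr_poly R m, forall G : 'M[R]_(m * m, m),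
       chr_eval P G = \det (ricci_s G) * chr_eval Q G) /\
    (exists2 G : 'M[R]_(m * m, m), torsion_free G & chr_eval P G != 0) /\
    forall p q : nat, (p + q)%N = m ->
      let WP := chr_stratum setT p q P in
      let ZP := chr_stratum torsion_free p q P in
      [/\ invariant_set chr_act WP,
          proper_action chr_act WP,
          without_fixed_points chr_act WP &
          exists (d : nat) (A : set (chart (orbit_space chr_act WP) d)),
            smooth_principal_bundle chr_act setT (@orbit_proj _ _ _ chr_act WP) A]
      /\
      [/\ invariant_set chr_act ZP,
          proper_action chr_act ZP,
          without_fixed_points chr_act ZP &
          exists (d : nat) (A : set (chart (orbit_space chr_act ZP) d)),
            smooth_principal_bundle chr_act torsion_free
              (@orbit_proj _ _ _ chr_act ZP) A].
Proof.
case: m hm => [//|n] hn.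
have isP := @is_chr_poly_coord R n.+1.
have Cc := @is_chr_poly_cst R n.+1.
have Ca := @is_chr_poly_add R n.+1.
have Cm := @is_chr_poly_mul R n.+1.
(* With [C] the class of polynomial functions, closure yields [P], and likewise the cofactor [Q]
   that shows divisibility by the Ricci determinant. *)
have [P PE] := closed_moduli_poly Cc Ca Cm isP.
have [Q QE] : is_chr_poly
    (fun G : 'M[R]_(n.+1 * n.+1, n.+1) => \det (trace_form G) * \det (poly_frame G)).
  apply: (Cm); apply: (closed_det Cc Ca Cm).
    exact: entrywise_trace_form.
  exact: entrywise_poly_frame.
have [G0 tG0 G0_neq0] := @moduli_poly_nonzero R n hn.
exists P; split; first by exists Q => G; rewrite PE QE.
split; first by exists G0; rewrite ?PE.
move=> p q _ /=; split.
  by apply: (chr_stratum_bundle p q _ _ _ G0_neq0 PE); [split|by []|by []].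
apply: (chr_stratum_bundle p q _ _ tG0 G0_neq0 PE).
  split=> [i j k|a x y tx ty i j k]; first by rewrite /chr !mxE.
  by rewrite /chr !mxE; congr (_ * _ + _); [exact: tx|exact: ty].
exact: torsion_free_act.
Qed.
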